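(* Let $R=k[x_1,x_2,x_3,x_4]$ and let $\Theta$ be a $2\times 4$ matrix of rank $2$ with entries in $R$ whose first and second rows consist of homogeneous polynomials of degrees $d_1$ and $d_2$, respectively, with $0\le d_1\le d_2$ and the gcd of the entries of each row equal to $1$. Let $\varepsilon=(x_1,x_2,x_3,x_4)^T:R(-1)\to R^4$ be the Euler vector and write $$\Theta\circ\varepsilon=\begin{bmatrix}h_1\\ h_2\end{bmatrix}:R(-1)\to R(d_1)\oplus R(d_2)$$ with $h_1,h_2$ homogeneous polynomials. If $(h_1,h_2)$ is a regular sequence, then $\operatorname{Syz}(\Theta)(1)$ is the graded module associated to the tangent sheaf of a codimension one distribution on $\mathbb P^3$.
   Context: $k$ is algebraically closed of characteristic zero. $\Theta$ defines a graded map $R^4\to R(d_1)\oplus R(d_2)$ and $\operatorname{Syz}(\Theta)=\ker\Theta$. A codimension one distribution on $\mathbb P^3$ is given by a rank-two subsheaf of the tangent sheaf $T\mathbb P^3$ (its tangent sheaf) such that the quotient of $T\mathbb P^3$ by it is torsion-free. The tangent sheaf $T\mathbb P^3$ is identified via the Euler sequence $0\to\mathcal O_{\mathbb P^3}(-1)\xrightarrow{\varepsilon}\mathcal O_{\mathbb P^3}^{\oplus4}\to T\mathbb P^3(-1)\to0$. *)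

(* Defs.v *)
From HB Require Import structures.
From mathcomp Require Import all_boot all_order all_algebra.
From mathcomp Require Import mpoly.
Set Implicit Arguments.
Unset Strict Implicit.
Unset Printing Implicit Defensive.
Import GRing.Theory.
Local Open Scope ring_scope.

(* MathComp world.

   P^3 is the classical projective variety over an algebraically closed field
   k.  A point is a nonzero vector up to scaling, and a subset of P^3 is
   represented by the cone over it (vertex removed), a subset of k^4.
   Sections of O(d) are functions on such cones.  Sections of
   TP^3(l) = O(l+1)^4 / O(l) eps are k^4-valued functions on such cones, where
   two functions are the same section if at each x they differ by a multiple
   of x. *)

Notation R4 k := {mpoly k[4]}.

Definition ev (k : closedFieldType) (p : R4 k) (x : 'cV[k]_4) : k :=
  p.@[fun i => x i 0].

Definition euler (k : closedFieldType) : 'cV[R4 k]_4 := \col_i 'X_i.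

(* Homogeneous of integral degree; only 0 is homogeneous of degree < 0. *)
Definition homogz (k : closedFieldType) (e : int) (p : R4 k) : Prop :=
  match e with
  | Posz n => p \is n.-homog
  | Negz _ => p = 0
  end.

Definition gcd_one (k : closedFieldType) (n : nat) (f : 'I_n -> R4 k) : Prop :=
  forall g : R4 k, (forall j, exists q, f j = q * g) -> g \is a GRing.unit.

(* (a, b) is a regular sequence: a is a nonzerodivisor on R, b is a
   nonzerodivisor on R/(a), and R/(a, b) is nonzero. *)
Definition regular_pair (k : closedFieldType) (a b : R4 k) : Prop :=
  [/\ forall r, a * r = 0 -> r = 0,
      forall r, (exists q, b * r = q * a) -> exists q, r = q * a
    & ~ exists r s, r * a + s * b = 1].

Section ProjectiveSpace.
Variable k : closedFieldType.
Local Notation pt := 'cV[k]_4.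
Implicit Types (U V W : pt -> Prop) (d l : int) (s t w : pt -> pt).

Definition whole : pt -> Prop := fun x => x != 0.

Definition zopen U : Prop :=
  exists S : R4 k -> Prop,
    (forall f, S f -> exists n : nat, f \is n.-homog) /\
    (forall x, U x <-> x != 0 /\ exists2 f, S f & ev f x != 0).

Definition onbhd U (p : pt) V : Prop :=
  [/\ zopen V, V p & forall x, V x -> U x].

Definition locally U (P : (pt -> Prop) -> Prop) : Prop :=
  forall p, U p -> exists2 V, onbhd U p V & P V.

Definition Osec d U (f : pt -> k) : Prop :=
  locally U (fun V => exists (m n : nat) (a b : R4 k),
    [/\ a \is m.-homog, b \is n.-homog, m%:Z - n%:Z = d
      & forall x, V x -> ev b x != 0 /\ f x = ev a x / ev b x]).

Definition O4sec d U w : Prop := forall i, Osec d U (fun x => w x i 0).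

Definition Teq U s t : Prop :=
  forall x, U x -> exists c : k, s x - t x = c *: x.

(* Sections of TP^3(l): locally images of sections of O(l+1)^4. *)
Definition Tsec l U s : Prop :=
  locally U (fun V => exists2 w, O4sec (l + 1) V w & Teq V s w).

Definition lincomb (n : nat) (f : 'I_n -> pt -> k) (s : 'I_n -> pt -> pt) :
  pt -> pt := fun x => \sum_(i < n) f i x *: s i x.

(* O-submodule sheaves of TP^3; sh_ext says that membership depends on the
   section only, not on the function representing it. *)
Record subsheaf (F : (pt -> Prop) -> (pt -> pt) -> Prop) : Prop := {
  sh_sub : forall U s, zopen U -> F U s -> Tsec 0 U s;
  sh_ext : forall U s t, zopen U -> F U s -> Teq U s t -> F U t;
  sh_zero : forall U, zopen U -> F U (fun _ => 0);
  sh_add : forall U s t, zopen U -> F U s -> F U t ->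
    F U (fun x => s x + t x);
  sh_scale : forall U f s, zopen U -> Osec 0 U f -> F U s ->
    F U (fun x => f x *: s x);
  sh_res : forall U V s, zopen U -> zopen V -> (forall x, V x -> U x) ->
    F U s -> F V s;
  sh_glue : forall U s, zopen U -> locally U (fun V => F V s) -> F U s
}.

Implicit Type F : (pt -> Prop) -> (pt -> pt) -> Prop.

(* Finite type; for a subsheaf of the coherent sheaf TP^3 this is
   coherence. *)
Definition coherent F : Prop :=
  locally whole (fun V => exists (n : nat) (s : 'I_n -> pt -> pt),
    (forall i, F V (s i)) /\
    forall W t, zopen W -> (forall x, W x -> V x) -> F W t ->
      locally W (fun W' => exists f : 'I_n -> pt -> k,
        (forall i, Osec 0 W' (f i)) /\ Teq W' t (lincomb f s))).

(* The generic stalk of F, the colimit of F U over nonempty open U, has a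
   basis of r elements over the function field of P^3. *)
Definition has_rank (r : nat) F : Prop :=
  exists (V : pt -> Prop) (s : 'I_r -> pt -> pt),
  [/\ zopen V /\ exists p, V p,
      forall i, F V (s i),
      forall W (f : 'I_r -> pt -> k),
        zopen W -> (exists p, W p) -> (forall x, W x -> V x) ->
        (forall i, Osec 0 W (f i)) -> Teq W (lincomb f s) (fun _ => 0) ->
        forall i x, W x -> f i x = 0
    & forall W t, zopen W -> (exists p, W p) -> F W t ->
        exists W' (f : 'I_r -> pt -> k),
        [/\ zopen W' /\ (exists p, W' p), forall x, W' x -> W x /\ V x,
            forall i, Osec 0 W' (f i) & Teq W' t (lincomb f s)]].

(* Every stalk of TP^3/F is torsion-free over the local ring: if the germ of
   f at p is nonzero and f s lies in F_p, then s lies in F_p. *)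
Definition torsion_free_quotient F : Prop :=
  forall p U s f, zopen U -> U p -> Tsec 0 U s -> Osec 0 U f ->
    ~ (exists2 V, onbhd U p V & forall x, V x -> f x = 0) ->
    (exists2 V, onbhd U p V & F V (fun x => f x *: s x)) ->
    exists2 V, onbhd U p V & F V s.

Definition codim1_distribution F : Prop :=
  [/\ subsheaf F, coherent F, has_rank 2 F & torsion_free_quotient F].

(* F(l) = F (x) O(l), as a subsheaf of TP^3(l). *)
Definition twist F l U s : Prop :=
  locally U (fun V =>
    exists (n : nat) (g : 'I_n -> pt -> k) (t : 'I_n -> pt -> pt),
    [/\ forall i, Osec l V (g i), forall i, F V (t i)
      & Teq V s (lincomb g t)]).

(* Data of a graded R-module whose degree-e part is {v | gin e v} modulo
   geq. *)
Record grmod := GrMod {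
  gcar : Type;
  gin : int -> gcar -> Prop;
  geq : gcar -> gcar -> Prop;
  gadd : gcar -> gcar -> gcar;
  gact : R4 k -> gcar -> gcar
}.

Definition gshift (a : int) (M : grmod) : grmod :=
  @GrMod (gcar M) (fun e => @gin M (e + a)) (@geq M) (@gadd M) (@gact M).

(* Isomorphism of graded R-modules, homogeneous of degree 0. *)
Definition griso (M N : grmod) : Prop :=
  exists phi : int -> gcar M -> gcar N,
  [/\ forall e v, gin e v -> gin e (phi e v),
      forall e u v, gin e u -> gin e v ->
        (geq (phi e u) (phi e v) <-> geq u v),
      forall e u v, gin e u -> gin e v ->
        geq (phi e (gadd u v)) (gadd (phi e u) (phi e v)),
      forall e (n : nat) (r : R4 k) v, r \is n.-homog -> gin e v ->
        geq (phi (e + n%:Z) (gact r v)) (gact r (phi e v))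
    & forall e y, gin e y -> exists2 v, gin e v & geq (phi e v) y].

(* The kernel of Theta : R^4 -> R(d1) (+) R(d2), graded as a submodule of
   R^4. *)
Definition Syz (Theta : 'M[R4 k]_(2, 4)) : grmod :=
  @GrMod 'cV[R4 k]_4
    (fun e v => Theta *m v = 0 /\ forall i, homogz e (v i 0))
    eq +%R (fun r v => r *: v).

(* The direct sum over all integers l of H^0(P^3, F(l)). *)
Definition Gamma_star F : grmod :=
  @GrMod (pt -> pt) (fun l s => twist F l whole s) (Teq whole)
    (fun s t x => s x + t x) (fun r s x => ev r x *: s x).

(* Exactness of O(d) -> O(d+1)^4 -> TP^3(d) on sections, so that Teq is
   equality in the cokernel of the Euler map. *)
Lemma zopenI_coord U (i : 'I_4) :
  zopen U -> zopen (fun x => U x /\ x i 0 != 0).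
Proof.
have evX (x : pt) : ev 'X_i x = x i 0 by rewrite /ev mevalXU.
case=> S [hS hU]; exists (fun g => exists2 f, S f & g = f * 'X_i).
split=> [g [f /hS[n hn] ->]|x].
  by exists (n + 1)%N; apply: dhomogM => //; rewrite dhomogX; apply/eqP/mdeg1.
split=> [[/hU[x0 [f Sf fx]] xi]|[x0 [g [f Sf ->]]]].
  split=> //; exists (f * 'X_i); first by exists f.
  by rewrite /ev mevalM -/(ev f x) -/(ev 'X_i x) evX mulf_neq0.
rewrite /ev mevalM -/(ev f x) -/(ev 'X_i x) evX mulf_eq0 negb_or.
by case/andP=> fx xi; split=> //; apply/hU; split=> //; exists f.
Qed.

Lemma euler_exact d U w : zopen U -> O4sec (d + 1) U w ->
  Teq U w (fun _ => 0) <->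
  exists2 g, Osec d U g & forall x, U x -> w x = g x *: x.
Proof.
move=> oU hw; split; last first.
  by case=> g _ hg x Ux; exists (g x); rewrite subr0 hg.
move=> w0.
pose g (x : pt) : k := if [pick i | x i 0 != 0] is Some i then w x i 0 / x i 0 else 0.
have nz (x : pt) : U x -> x != 0 by case: oU => S [_ hU] /hU[].
have gE (x : pt) i : U x -> x i 0 != 0 -> g x = w x i 0 / x i 0.
  move=> Ux xi; have [c] := w0 x Ux; rewrite subr0 /g => ->.
  case: pickP => [j xj|/(_ i)]; last by rewrite xi.
  by rewrite !mxE !mulfK.
have ex (x : pt) : U x -> exists i, x i 0 != 0.
  move=> /nz x0; apply/existsP; apply: contraNT x0; rewrite negb_exists.
  move/forallP=> h; apply/eqP/matrixP=> i j; rewrite (ord1 j) mxE.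
  by apply/eqP; have := h i; rewrite negbK.
exists g => [p Up|x Ux]; last first.
  have [i xi] := ex x Ux; rewrite (gE x i) //.
  by have [c] := w0 x Ux; rewrite subr0 => ->; rewrite mxE mulfK.
have [i pi] := ex p Up.
have [V [oV Vp VU] [m [n [a [b [ha hb hd hab]]]]]] := hw i p Up.
exists (fun x => V x /\ x i 0 != 0).
  by split=> [||x [/VU]] //; apply: zopenI_coord.
exists m, (n + 1)%N, a, (b * 'X_i); split=> //.
- by apply: dhomogM => //; rewrite dhomogX; apply/eqP/mdeg1.
- by rewrite PoszD opprD addrA hd addrK.
move=> x [Vx xi]; have [bx wx] := hab x Vx.
have -> : ev (b * 'X_i) x = ev b x * x i 0 by rewrite /ev mevalM mevalXU.
split; first exact: mulf_neq0.
by rewrite (gE x i (VU x Vx) xi) wx invfM mulrA.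
Qed.

End ProjectiveSpace.

(* Main.v *)
(** Let [K = ker Theta] as a sheaf on P^3. Since [h_1 <> 0], no nonzero section
    of [K] is a multiple of the Euler section, so [K(1)] embeds in TP^3; it is
    coherent because R is noetherian, and has rank 2. If [f s] lies in [K(1)]
    for a local section [s = A / b] of TP^3 and [f <> 0], then [Theta A] and [h]
    are proportional; as [(h_1, h_2)] is regular, [Theta A = q h], so
    [A - q eps] is a syzygy representing [b s]: the quotient is torsion-free.
    A global section of [K(l + 1)] is a compatible family of fractions [A / b]
    of degree [l + 1], which is a vector of polynomials by a Hartogs argument. *)

Require Import Defs.
From HB Require Import structures.
From mathcomp Require Import all_boot all_order all_algebra.
From mathcomp Require Import mpoly.
From mathcomp Require Import ring zify.
From Stdlib Require Import Classical.
Set Implicit Arguments.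
Unset Strict Implicit.
Unset Printing Implicit Defensive.
Import Order.TTheory GRing.Theory.
Local Open Scope ring_scope.

(** Sections are functions on cones, so identities between local data are checked at points where
    finitely many polynomials do not vanish, and lift to R because k is infinite. A function
    represents a section of TP^3 only modulo multiples of x, so a column of fractions A / b
    presenting it is not determined; among syzygies it is, because h_1 is nonzero, and this is what
    turns a global section into one compatible family of fractions. The Hartogs step works one
    coordinate at a time and rests on division in a single variable instead of unique factorization
    in R. For coherence, the generators found by noetherianity need not be homogeneous, so they are
    dehomogenized on each chart x_i ≠ 0. Degrees are shifted by one throughout: TP^3 is a quotient
    of O(1)^4, so sections of F(l) come from syzygies of degree l + 1, which is the twist in
    Syz(Theta)(1). *)

Lemma ord2P (r : 'I_2) : r = 0 \/ r = 1.
Proof. by case: r => [[|[|]]] // ?; [left|right]; apply: val_inj. Qed.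

(** * Polynomials as functions *)

Lemma closedField_infinite (k : closedFieldType) (n : nat) :
  exists2 s : seq k, uniq s & size s = n.
Proof.
elim: n => [|n [s us <-]]; first by exists [::].
have: \prod_(a <- s) ('X - a%:P) != 0 :> {poly k}.
  by rewrite prodf_seq_neq0; apply/allP => a _; rewrite polyXsubC_eq0.
case/closed_nonrootP => a; rewrite root_prod_XsubC => ans.
by exists (a :: s); rewrite //= ans us.
Qed.

(** The infinite field k embeds in the domain S, giving more roots than the size of [p] allows.
    Taking S to be a polynomial ring over k lets variables be freed one by one. *)
Lemma poly_eq0_on_field (k : closedFieldType) (S : idomainType)
    (f : {rmorphism k -> S}) (p : {poly S}) :
  (forall a, p.[f a] = 0) -> p = 0.
Proof.
move=> p0; apply/eqP; apply: contraT => pn0.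
have [s us ss] := closedField_infinite k (size p).
have: (size (map f s) < size p)%N.
  apply: max_poly_roots => //; last by rewrite map_inj_uniq //; apply: fmorph_inj.
  by apply/allP => _ /mapP[a _ ->]; apply/eqP/p0.
by rewrite size_map ss ltnn.
Qed.

Lemma horner_mmap (n : nat) (A S : comNzRingType) (f : {rmorphism A -> S})
    (h : 'I_n -> {poly S}) (p : {mpoly A[n]}) (r : S) :
  (mmap (polyC \o f) h p).[r] = mmap f (fun i => (h i).[r]) p.
Proof.
rewrite /mmap horner_sum; apply: eq_bigr => m _.
rewrite /= hornerM hornerC /mmap1; congr (_ * _).
by rewrite horner_prod; apply: eq_bigr => i _; rewrite horner_exp.
Qed.

Lemma mmap_ext (n : nat) (A S : nzRingType) (f : A -> S) (h g : 'I_n -> S) p :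
  h =1 g -> mmap f h p = mmap f g p.
Proof.
move=> hg; apply: eq_bigr => m _; congr (_ * _).
by apply: eq_bigr => i _; rewrite hg.
Qed.

Lemma rmorph_mmap (n : nat) (A S S' : comNzRingType) (f : {rmorphism A -> S})
    (g : {rmorphism S -> S'}) (h : 'I_n -> S) p :
  g (mmap f h p) = mmap (g \o f) (g \o h) p.
Proof.
rewrite /mmap rmorph_sum; apply: eq_bigr => m _.
rewrite rmorphM /= /mmap1 rmorph_prod; congr (_ * _).
by apply: eq_bigr => i _; rewrite rmorphXn.
Qed.

Lemma mmap_id (n : nat) (A : comNzRingType) (p : {mpoly A[n]}) :
  mmap (@mpolyC n A) (fun i => 'X_i) p = p.
Proof.
by rewrite [RHS]mpolyE; apply: eq_bigr => m _; rewrite mul_mpolyC mmap1_id.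
Qed.

(* Freeing one variable at a time: a polynomial that vanishes on all constants
   in the i-th slot also vanishes on every polynomial in that slot. *)
Lemma mpoly_eq0_of_eval (k : closedFieldType) (n : nat) (p : {mpoly k[n]}) :
  (forall v, p.@[v] = 0) -> p = 0.
Proof.
move=> p0; rewrite -[LHS]mmap_id.
have gen (j : nat) (h : 'I_n -> {mpoly k[n]}) :
    (forall i : 'I_n, (j <= i)%N -> exists a, h i = a%:MP) ->
    mmap (@mpolyC n k) h p = 0.
  elim: j h => [|j IH] h hh.
    have /fin_all_exists[a ha] : forall i, exists a, h i = a%:MP by move=> i; apply: hh.
    rewrite (mmap_ext _ _ ha) -[RHS]mpolyC0 -(p0 a) /meval.
    by rewrite (rmorph_mmap idfun (@mpolyC n k)).
  have [nj|jn] := leqP n j.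
    by apply: IH => i; rewrite leqNgt (leq_trans (ltn_ord i) nj).
  pose i0 := Ordinal jn.
  pose h' (i : 'I_n) : {poly {mpoly k[n]}} := if i == i0 then 'X else (h i)%:P.
  have q0 : mmap (polyC \o @mpolyC n k) h' p = 0.
    apply: (@poly_eq0_on_field k _ (@mpolyC n k)) => a.
    rewrite horner_mmap; apply: IH => i ij; rewrite /h'.
    case: eqVneq => [_|ni]; first by exists a; rewrite hornerX.
    rewrite hornerC; apply: hh; rewrite ltn_neqAle ij andbT.
    by rewrite eq_sym -(inj_eq val_inj) /= in ni *.
  have := horner_mmap (@mpolyC n k) h' p (h i0); rewrite q0 horner0 => ->.
  by apply: mmap_ext => i; rewrite /h'; case: eqVneq => [->|_]; rewrite ?hornerX ?hornerC.
by apply: (gen n) => i; rewrite leqNgt ltn_ord.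
Qed.

(** * Homogeneous components, homogeneous factors, homogenization *)

Section Homog.
Variables (k : closedFieldType) (n : nat).
Local Notation R := {mpoly k[n]}.

Lemma dhomog_eval (d : nat) (p : R) (a : k) (v : 'I_n -> k) :
  p \is d.-homog -> p.@[fun i => a * v i] = a ^+ d * p.@[v].
Proof.
move=> /dhomogP hp; rewrite !mevalE big_distrr /= !big_seq; apply: eq_bigr => m mp.
rewrite mulrCA; congr (_ * _); rewrite -(hp m mp) /= mdegE -prodrXr -big_split /=.
by apply: eq_bigr => i _; rewrite exprMn.
Qed.

Lemma pihomogM (q b : R) (j d : nat) : b \is d.-homog ->
  pihomog mdeg (j + d) (q * b) = pihomog mdeg j q * b.
Proof.
move=> hb; pose N := maxn (mmeasure mdeg q) j.+1.
rewrite {1}(pihomog_partitionE (leq_maxl _ _ : _ <= N)%N) mulr_suml raddf_sum.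
have jN : (j < N)%N by apply: leq_maxr.
rewrite (bigD1 (Ordinal jN)) //= big1 ?addr0 => [|i ij].
  by rewrite pihomog_dE // dhomogM ?pihomogP.
apply: (@pihomog_ne0 _ _ _ (i + d)%N); last exact: dhomogM (pihomogP _ _ _) hb.
by rewrite eqn_add2r -(inj_eq val_inj) in ij *.
Qed.

Lemma pihomogM_lt (q b : R) (j d : nat) : b \is d.-homog -> (j < d)%N ->
  pihomog mdeg j (q * b) = 0.
Proof.
move=> hb jd.
rewrite {1}(pihomog_partitionE (leqnn (mmeasure mdeg q))) mulr_suml raddf_sum.
rewrite big1 // => i _.
apply: (@pihomog_ne0 _ _ _ (i + d)%N); last exact: dhomogM (pihomogP _ _ _) hb.
by apply/eqP => /= e; move: jd; rewrite -e ltnNge leq_addl.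
Qed.

(** Multiplication by [b] shifts homogeneous components by [d]; taking the component of degree [m]
    of [q * b] and cancelling [b] leaves a single component of [q], or none when m < d. *)
Lemma dhomog_factor (q b : R) (m d : nat) : b != 0 -> b \is d.-homog ->
  q * b \is m.-homog -> (d <= m)%N /\ q \is (m - d).-homog \/ q = 0.
Proof.
move=> b0 hb hqb; have [dm|md] := leqP d m; [left|right].
  split=> //; rewrite homog_piE; apply/eqP/(mulIf b0); rewrite -(pihomogM _ _ hb) subnK //.
  by rewrite pihomog_dE.
apply: (mulIf b0); rewrite mul0r -(pihomogM_lt q hb md).
by rewrite pihomog_dE.
Qed.

(* [homogenize i N p] evaluates to [x_i ^ N p(x / x_i)] where [x_i <> 0]. *)
Definition homogenize (i : 'I_n) (N : nat) (p : R) : R :=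
  \sum_(m <- msupp p) p@_m *: ('X_[m] * 'X_i ^+ (N - mdeg m)).

Lemma dhomogXU (i : 'I_n) : ('X_i : R) \is 1.-homog.
Proof. by rewrite dhomogX; apply/eqP/mdeg1. Qed.

Lemma dhomogXn (i : 'I_n) (e : nat) : ('X_i ^+ e : R) \is e.-homog.
Proof. by have := dhomogMn e (dhomogXU i); rewrite mul1n. Qed.

Lemma homogenize_homog i N p : (msize p <= N.+1)%N -> homogenize i N p \is N.-homog.
Proof.
move=> pN; rewrite /homogenize big_seq; apply: rpred_sum => m mp; apply: rpredZ.
have mN : (mdeg m <= N)%N by rewrite -ltnS (leq_trans (msize_mdeg_lt mp) pN).
rewrite -{2}(subnKC mN); apply: dhomogM (dhomogXn _ _).
by rewrite dhomogX; apply/eqP.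
Qed.

Lemma homogenize_eval i N p (v : 'I_n -> k) : (msize p <= N.+1)%N -> v i != 0 ->
  (homogenize i N p).@[v] = v i ^+ N * p.@[fun j => (v i)^-1 * v j].
Proof.
move=> pN vi; rewrite /homogenize raddf_sum mevalE big_distrr /= !big_seq.
apply: eq_bigr => m mp; rewrite mevalZ mevalM mevalX rmorphXn /= mevalXU.
rewrite [RHS]mulrCA; congr (_ * _).
have mN : (mdeg m <= N)%N by rewrite -ltnS (leq_trans (msize_mdeg_lt mp) pN).
have -> : \prod_(j < n) ((v i)^-1 * v j) ^+ m j =
    (v i)^-1 ^+ mdeg m * \prod_(j < n) v j ^+ m j.
  rewrite mdegE -prodrXr -big_split /=.
  by apply: eq_bigr => j _; rewrite exprMn.
rewrite mulrA mulrC; congr (_ * _).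
by rewrite expfB_cond ?exprVn // (negPf vi).
Qed.

End Homog.

(** * Noetherianity *)

(** Dickson's lemma, for exponents attached to arbitrary objects. In the induction, [s] handles the
    first n exponents; it also dominates every x whose exponent n reaches the bound [N] over [s],
    and each of the finitely many smaller values of that exponent gets a finite set of its own. *)
Lemma dickson (T : eqType) (w : T -> nat -> nat) (n : nat) (L : T -> Prop) :
  exists2 s : seq T, forall y, y \in s -> L y
    & forall x, L x -> exists2 y, y \in s & forall i, (i < n)%N -> (w y i <= w x i)%N.
Proof.
elim: n L => [|n IH] L.
  have [[x Lx]|nL] := classic (exists x, L x).
    exists [:: x] => [y|y _]; first by rewrite inE => /eqP->.
    by exists x; rewrite ?inE.
  by exists [::] => // x Lx; case: nL; exists x.
have [s sL sP] := IH L.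
pose N := (\max_(y <- s) w y n).+1.
have /fin_all_exists[u uP] (j : 'I_N) : exists u : seq T,
    (forall y, y \in u -> L y /\ w y n = j) /\
    forall x, L x /\ w x n = j ->
      exists2 y, y \in u & forall i, (i < n)%N -> (w y i <= w x i)%N.
  by have [u uL uP] := IH (fun x => L x /\ w x n = j); exists u.
exists (s ++ flatten [seq u j | j <- enum 'I_N]) => [y|x Lx].
  rewrite mem_cat => /orP[/sL//|/flatten_mapP[j _ yj]].
  by have [/(_ y yj)[]] := uP j.
have [wN|Nw] := ltnP (w x n) N.
  have [_ /(_ x (conj Lx erefl))[y yu yx]] := uP (Ordinal wN).
  exists y => [|i].
    rewrite mem_cat; apply/orP; right; apply/flatten_mapP.
    by exists (Ordinal wN); rewrite ?mem_enum.
  rewrite ltnS leq_eqVlt => /orP[/eqP->|/yx//].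
  by have [/(_ y yu)[_ ->]] := uP (Ordinal wN).
have [y ys yx] := sP x Lx; exists y => [|i]; first by rewrite mem_cat ys.
rewrite ltnS leq_eqVlt => /orP[/eqP->|/yx//].
by apply: leq_trans (ltnW Nw); rewrite (leq_bigmax_seq y).
Qed.

Section Noetherian.
Variables (K : fieldType) (n r : nat).
Local Notation R := {mpoly K[n]}.
Local Notation span s v :=
  (exists c : 'I_(size s) -> R, v = \sum_i c i *: s`_i).

Lemma span_mem (s : seq 'cV[R]_r) v : v \in s -> span s v.
Proof.
move=> vs; have vi : (index v s < size s)%N by rewrite index_mem.
exists (fun i => (i == Ordinal vi)%:R).
rewrite (bigD1 (Ordinal vi)) //= eqxx scale1r nth_index // big1 ?addr0 // => i.
by move=> /negPf->; rewrite scale0r.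
Qed.

Lemma span_lin (s : seq 'cV[R]_r) a u v : span s u -> span s v -> span s (a *: u + v).
Proof.
move=> [c ->] [d ->]; exists (fun i => a * c i + d i).
rewrite scaler_sumr -big_split; apply: eq_bigr => i _.
by rewrite scalerDl scalerA.
Qed.

(* The submodule is generated by finitely many elements whose leading terms
   (first nonzero coordinate, then leading monomial) are minimal. *)
Lemma submodule_fg (M : 'cV[R]_r -> Prop) :
  (forall a u v, M u -> M v -> M (a *: u + v)) ->
  exists2 s : seq 'cV[R]_r, forall v, v \in s -> M v & forall v, M v -> span s v.
Proof.
move=> Mlin; pose lead (j : 'I_r) (v : 'cV[R]_r) :=
  (forall i : 'I_r, (i < j)%N -> v i 0 = 0) /\ v j 0 != 0.
pose w j (v : 'cV[R]_r) i := if insub i is Some i then mlead (v j 0) i else 0%N.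
have /fin_all_exists2[t tM tP] (j : 'I_r) :=
  dickson (w j) n (fun v => M v /\ lead j v).
pose s := flatten [seq t j | j <- enum 'I_r]; exists s.
  by move=> v /flatten_mapP[j _ /tM[]].
have ts j v : v \in t j -> v \in s.
  by move=> vt; apply/flatten_mapP; exists j; rewrite ?mem_enum.
(* Double induction: on the number d of last coordinates that may be nonzero, then on the leading
   monomial of the first of them, which subtracting a multiple of a generator lowers or cancels. *)
suff gen d (v : 'cV[R]_r) : M v -> (forall i : 'I_r, (i < r - d)%N -> v i 0 = 0) -> span s v.
  by move=> v Mv; apply: (gen r) => // i; rewrite subnn.
elim: d v => [|d IHd] v Mv v0.
  exists (fun=> 0); rewrite big1 => [|i _]; last by rewrite scale0r.
  by apply/matrixP => i j; rewrite ord1 mxE v0 // subn0.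
have [rd|dr] := leqP r d.
  by apply: IHd => // i; rewrite (eqP (_ : (r - d)%N == 0)%N) // subn_eq0.
have jr : (r - d.+1 < r)%N by rewrite ltn_subrL (leq_ltn_trans _ dr).
pose j := Ordinal jr.
have step u : M u -> (forall i : 'I_r, (i < j)%N -> u i 0 = 0) -> u j 0 = 0 -> span s u.
  move=> Mu u0 uj; apply: IHd => // i; rewrite /j /= subnS in u0.
  rewrite -(prednK (_ : 0 < r - d)%N) ?subn_gt0 // ltnS leq_eqVlt.
  case/orP => [/eqP ij|/u0//]; suff -> : i = j by [].
  by apply: val_inj; rewrite /= ij subnS.
move: {2}(v j 0) (erefl (v j 0)) => p; elim/mleadrect: p v Mv v0 => p IHp v Mv v0 vj.
have [p0|pn0] := eqVneq p 0; first by apply: step => //; rewrite vj.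
have [g gt gv] : exists2 g : 'cV[R]_r, g \in t j &
    forall i, (i < n)%N -> (w j g i <= w j v i)%N.
  by apply: tP; split=> //; split; rewrite ?vj.
have [Mg [g0 gj]] := tM j g gt.
have le_gv : (mlead (g j 0%R) <= mlead p)%MM.
  apply/mnm_lepP => i; have := gv i (ltn_ord i).
  by rewrite /w insubT //= => lti; rewrite -vj (_ : Sub _ _ = i) //; apply: val_inj.
pose a : R := (mleadc p / mleadc (g j 0)) *: 'X_[mlead p - mlead (g j 0%R)].
have lg : mleadc (g j 0) != 0 by rewrite mleadc_eq0.
have aM : mleadc p / mleadc (g j 0) != 0 by rewrite mulf_neq0 ?invr_eq0 ?mleadc_eq0.
have a0 : a != 0 by rewrite scaler_eq0 negb_or aM -msupp_eq0 msuppX.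
have la : mlead a = (mlead p - mlead (g j 0%R))%MM by rewrite mleadZ // mleadXm.
pose v' := (- a) *: g + v.
have Mv' : M v' by apply: Mlin.
have v'0 (i : 'I_r) : (i < j)%N -> v' i 0 = 0.
  by move=> ij; rewrite !mxE g0 // v0 // mulr0 addr0.
have -> : v = a *: g + v' by rewrite /v' addrA -scalerDl subrr scale0r add0r.
apply: span_lin; first exact/span_mem/(ts j).
have v'j : v' j 0 = p - a * g j 0 by rewrite !mxE vj mulNr addrC.
have [q0|qn0] := eqVneq (v' j 0) 0; first exact: step.
apply: (IHp (v' j 0)) => //.
have lag : mlead (a * g j 0) = mlead p by rewrite mleadM // la submK.
have le1 : (mlead (v' j 0) <= mlead p)%O.
  by rewrite v'j (le_trans (mleadB_le _ _)) // lag joinxx.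
rewrite lt_neqAle le1 andbT; apply: contraNneq qn0 => e.
have: mleadc (a * g j 0) = mleadc p.
  by rewrite mleadM // mleadcM /a mleadcZE mleadXm mcoeffX eqxx mulr1 divfK.
by rewrite lag -mleadc_eq0 e v'j mcoeffB => ->; rewrite subrr.
Qed.

End Noetherian.

(** * Hartogs extension *)

(** A rational function on the affine line without poles is a polynomial. At a root t of the
    denominator in lowest terms, comparison with a fraction whose denominator is nonzero at t would
    make t a root of the coprime numerator as well. *)
Lemma proportional_dvdp (k : closedFieldType) (Q : {poly k} -> {poly k} -> Prop) :
  (forall a b a' b', Q a b -> Q a' b' -> a * b' = a' * b) ->
  (forall t, exists a b, Q a b /\ b.[t] != 0) ->
  forall a b, Q a b -> b %| a.
Proof.
move=> Qprop Qcov a b Qab.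
have [b0|bn0] := eqVneq b 0.
  have [a1 [b1 [Q1 nz]]] := Qcov 0.
  have /eqP := Qprop _ _ _ _ Qab Q1; rewrite b0 mulr0 mulf_eq0 => /orP[/eqP->|].
    exact: dvdp0.
  by move=> /eqP b10; rewrite b10 horner0 eqxx in nz.
pose g := gcdp a b; have gn0 : g != 0 by rewrite gcdp_eq0 negb_and bn0 orbT.
have cop : coprimep (b %/ g) (a %/ g).
  by rewrite coprimep_sym; apply: coprimep_div_gcd; rewrite bn0 orbT.
have [s1|/closed_rootP[t rt]] := eqVneq (size (b %/ g)) 1%N.
  have /size_poly1P[c c0 bE] : size (b %/ g) == 1%N by rewrite s1.
  apply: dvdp_trans (dvdp_gcdl a b).
  by rewrite -{1}(divpK (dvdp_gcdr a b)) -/g bE mul_polyC dvdpZl.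
have [a1 [b1 [Q1 nz]]] := Qcov t.
have /(mulIf gn0)/(congr1 (horner^~ t)) : (a %/ g * b1) * g = (a1 * (b %/ g)) * g.
  by rewrite mulrAC divpK ?dvdp_gcdl // -mulrA divpK ?dvdp_gcdr //; apply: Qprop.
rewrite !hornerM (eqP rt) mulr0 => /eqP; rewrite mulf_eq0 (negPf nz) orbF.
by rewrite (negPf (coprimep_root cop rt)).
Qed.

Section Hartogs.
Variables (k : closedFieldType) (n : nat) (i : 'I_n).
Local Notation R := {mpoly k[n]}.

(** Slot i becomes the univariate indeterminate. Thus [lift] reads a polynomial as one in ['X_i]
    with coefficients kept in R, and [line v] restricts it to the line through v parallel to the
    i-th axis. *)
Let free (S : nzRingType) (h : 'I_n -> S) (j : 'I_n) : {poly S} :=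
  if j == i then 'X else (h j)%:P.

Let lift : R -> {poly R} := mmap (polyC \o @mpolyC n k) (free (fun j => 'X_j)).

Let line (v : 'I_n -> k) : R -> {poly k} := mmap (polyC \o idfun) (free v).

Let axis (j : 'I_n) : k := (j == i)%:R.

Lemma lift_eval p : (lift p).['X_i] = p.
Proof.
rewrite /lift (horner_mmap (@mpolyC n k)) -[RHS]mmap_id.
by apply: mmap_ext => j; rewrite /free; case: eqVneq => [->|_]; rewrite ?hornerX ?hornerC.
Qed.

Lemma line_lift v p : line v p = map_poly (meval v) (lift p).
Proof.
rewrite /lift (rmorph_mmap (polyC \o @mpolyC n k) (map_poly (meval v))) /line.
rewrite [LHS](@mmap_ext _ _ _ _ _ (map_poly (meval v) \o free (fun j => 'X_j))).
  by apply: eq_bigr => m _ /=; rewrite map_polyC /= mevalC.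
by move=> j; rewrite /free /=; case: eqP => _; rewrite ?map_polyX ?map_polyC //= mevalXU.
Qed.

Lemma line_eval v p t : (line v p).[t] = p.@[fun j => if j == i then t else v j].
Proof.
rewrite /line (horner_mmap idfun); apply: mmap_ext => j.
by rewrite /free; case: eqVneq => _; rewrite ?hornerX ?hornerC.
Qed.

(** In degree d only the pure power of ['X_i] can contribute to the coefficient of index d, so that
    coefficient is a constant, the value of [b] at the i-th axis point. When nonzero it is a unit,
    which permits division by [lift b]. *)
Lemma lift_homog d (b : R) : b \is d.-homog ->
  (size (lift b) <= d.+1)%N /\ (lift b)`_d = (b.@[axis])%:MP.
Proof.
move=> hb.
have term m : mmap1 (free (fun j => 'X_j : R)) m =
    (\prod_(j < n | j != i) 'X_j ^+ m j)%:P * 'X^(m i).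
  rewrite /mmap1 (bigD1 i) //= mulrC {2}/free eqxx; congr (_ * _).
  rewrite rmorph_prod; apply: eq_bigr => j ji.
  by rewrite /free (negPf ji) rmorphXn.
have mdE m : mdeg m = (m i + \sum_(j < n | j != i) m j)%N.
  by rewrite mdegE (bigD1 i).
have mi m : m \in msupp b -> (m i <= d)%N.
  by move=> /(dhomog_mf hb) /= <-; rewrite mdE leq_addr.
have liftE : lift b = \sum_(m <- msupp b)
    ((b@_m)%:MP * \prod_(j < n | j != i) 'X_j ^+ m j)%:P * 'X^(m i).
  by apply: eq_bigr => m _; rewrite term polyCM mulrA.
rewrite liftE; split.
  rewrite big_seq; apply: (leq_trans (size_sum _ _ _)); apply/bigmax_leqP_seq => m mb _.
  by rewrite mul_polyC (leq_trans (size_scale_leq _ _)) // size_polyXn ltnS mi.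
rewrite coef_sum mevalE rmorph_sum /= !big_seq; apply: eq_bigr => m mb.
rewrite coefCM coefXn rmorphM /= -mulrA; congr (_ * _).
rewrite [in RHS](bigD1 i) //= /axis eqxx expr1n mul1r.
have := dhomog_mf hb mb; rewrite /= mdE => dE.
have [di|di] := eqVneq d (m i).
  have m0 j : j != i -> m j = 0%N.
    move=> ji; apply/eqP; rewrite -leqn0.
    have: (\sum_(j < n | j != i) m j == 0)%N by rewrite -(eqn_add2l (m i)) dE di addn0.
    by rewrite sum_nat_eq0 => /forall_inP/(_ j ji)/eqP->.
  by rewrite mulr1 !big1 // => j ji; rewrite m0.
have: (\sum_(j < n | j != i) m j != 0)%N.
  by apply: contraNneq di => s0; rewrite -dE s0 addn0.
rewrite sum_nat_eq0 negb_forall_in => /exists_inP[j ji mj].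
rewrite mulr0 (bigD1 j) //= (negPf ji) expr0n (negPf mj) mul0r.
by rewrite mpolyC0.
Qed.

(* A homogeneous denominator [b] not vanishing on the i-th axis is monic in
   ['X_i] up to a constant, so divide [a] by [b] in that variable; on every
   line parallel to the axis and missing the origin the remainder vanishes,
   because there [a / b] is everywhere regular. *)
Lemma hartogs (Q : R -> R -> Prop) :
  (exists j, j != i) ->
  (forall a b, Q a b -> exists d, b \is d.-homog) ->
  (forall a b a' b', Q a b -> Q a' b' -> a * b' = a' * b) ->
  (forall v, (exists j, v j != 0) -> exists a b, Q a b /\ b.@[v] != 0) ->
  exists P, forall a b, Q a b -> a = P * b.
Proof.
move=> [j ji] Qhom Qprop Qcov.
have [|a [b [Qab bi]]] := Qcov axis; first by exists i; rewrite /axis eqxx oner_eq0.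
have b0 : b != 0 by apply: contraNneq bi => ->; rewrite meval0.
suff [P aP] : exists P, a = P * b.
  exists P => a' b' Qab'; apply: (mulIf b0).
  by rewrite -(Qprop _ _ _ _ Qab Qab') aP mulrAC.
have [d hb] := Qhom _ _ Qab; have [sb cb] := lift_homog hb.
have cb0 : (lift b)`_d != 0 by rewrite cb mpolyC_eq0.
have sbE : size (lift b) = d.+1.
  by apply/eqP; rewrite eqn_leq sb ltnNge; apply: contra cb0 => /(nth_default 0)->.
have lu : lead_coef (lift b) \is a GRing.unit.
  by rewrite lead_coefE sbE /= cb rmorph_unit // unitfE.
pose q := lift a %/ lift b; pose r := lift a %% lift b.
have divE : lift a = q * lift b + r by apply: Pdiv.IdomainUnit.divp_eq.
have sr : (size r < d.+1)%N.
  by rewrite -sbE Pdiv.CommonIdomain.ltn_modp -size_poly_eq0 sbE.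
exists q.['X_i]; rewrite -[LHS]lift_eval divE hornerD hornerM lift_eval.
suff -> : r.['X_i] = 0 by rewrite addr0.
have Xj : 'X_j != 0 :> R by rewrite -msupp_eq0 msuppX.
(* The factor ['X_j], with j different from i, discards the points with v_j = 0; every remaining
   line parallel to the i-th axis misses the origin, so [Qcov] applies all along it. *)
apply: (mulIf Xj); rewrite mul0r; apply: mpoly_eq0_of_eval => v.
rewrite mevalM mevalXU; have [->|vj] := eqVneq (v j) 0; first by rewrite mulr0.
have dvd : line v b %| line v a.
  apply: (@proportional_dvdp _ (fun f g => exists a b, [/\ Q a b, f = line v a & g = line v b])).
  - move=> _ _ _ _ [a1 [b1 [Q1 -> ->]]] [a2 [b2 [Q2 -> ->]]].
    by rewrite -!rmorphM /= (Qprop _ _ _ _ Q1 Q2).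
  - move=> t; pose v' l := if l == i then t else v l.
    have [|a1 [b1 [Q1 nz]]] := Qcov v'; first by exists j; rewrite /v' (negPf ji).
    by exists (line v a1), (line v b1); split; [exists a1, b1|rewrite line_eval].
  - by exists a, b.
pose rv := map_poly (meval v) r.
have lineE : line v a = map_poly (meval v) q * line v b + rv.
  by rewrite !line_lift divE rmorphD rmorphM.
have rv0 : rv = 0.
  (* The coefficient of index d of [lift b] is a nonzero constant and survives specialization, so
     [line v b] keeps degree d, while [rv] has smaller degree and cannot be a nonzero multiple of
     it. *)
  apply/eqP; apply: contraTT dvd => rvn0.
  rewrite lineE dvdp_addr ?dvdp_mull //.
  apply/negP => /(dvdp_leq rvn0); apply/negP; rewrite -ltnNge.
  apply: leq_ltn_trans (size_poly _ _) (leq_trans sr _).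
  rewrite ltnNge line_lift; apply: contra bi => /(nth_default 0).
  by rewrite coef_map /= cb mevalC => ->.
have -> : r.['X_i].@[v] = rv.[v i].
  by rewrite -horner_map /= mevalXU.
by rewrite rv0 horner0 mul0r.
Qed.

End Hartogs.

(** * Local fractions *)

Section Charts.
Variable k : closedFieldType.
Local Notation R := {mpoly k[4]}.
Local Notation pt := 'cV[k]_4.
Implicit Types (U V : pt -> Prop) (x p : pt) (f g a b : R).

Definition evmx x (m n : nat) (A : 'M[R]_(m, n)) : 'M[k]_(m, n) :=
  map_mx (meval (fun i => x i 0)) A.

Lemma evM x f g : ev (f * g) x = ev f x * ev g x.
Proof. exact: mevalM. Qed.

Lemma evB x f g : ev (f - g) x = ev f x - ev g x.
Proof. exact: mevalB. Qed.

Lemma ev0 x : ev 0 x = 0.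
Proof. exact: meval0. Qed.

Lemma ev1 x : ev 1 x = 1.
Proof. exact: meval1. Qed.

Lemma evX x i : ev 'X_i x = x i 0.
Proof. exact: mevalXU. Qed.

Lemma evXn x f e : ev (f ^+ e) x = ev f x ^+ e.
Proof. exact: rmorphXn. Qed.

Lemma ev_homog d f x (c : k) : f \is d.-homog -> ev f (c *: x) = c ^+ d * ev f x.
Proof.
move=> hf; rewrite -dhomog_eval //; apply: meval_eq => i.
by rewrite mxE.
Qed.

Lemma evmxE x m n (A : 'M[R]_(m, n)) i j : evmx x A i j = ev (A i j) x.
Proof. by rewrite mxE. Qed.

Lemma evmxM x m n q (A : 'M[R]_(m, n)) (B : 'M[R]_(n, q)) :
  evmx x (A *m B) = evmx x A *m evmx x B.
Proof. exact: map_mxM. Qed.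

Lemma evmxD x m n (A B : 'M[R]_(m, n)) : evmx x (A + B) = evmx x A + evmx x B.
Proof. exact: map_mxD. Qed.

Lemma evmxB x m n (A B : 'M[R]_(m, n)) : evmx x (A - B) = evmx x A - evmx x B.
Proof. exact: map_mxB. Qed.

Lemma evmx0 x m n : evmx x (0 : 'M[R]_(m, n)) = 0.
Proof. exact: map_mx0. Qed.

Lemma evmxZ x m n f (A : 'M[R]_(m, n)) : evmx x (f *: A) = ev f x *: evmx x A.
Proof. exact: map_mxZ. Qed.

Lemma evmx_euler x : evmx x (euler k) = x.
Proof. by apply/matrixP => i j; rewrite evmxE mxE evX ord1. Qed.

Lemma pt_neq0P x : reflect (exists i, x i 0 != 0) (x != 0).
Proof.
apply: (iffP idP) => [x0|[i]]; last by apply: contraNneq => ->; rewrite mxE.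
apply/existsP; apply: contraNT x0; rewrite negb_exists => /forallP h.
apply/eqP/matrixP => i j; rewrite (ord1 j) mxE; apply/eqP.
by have := h i; rewrite negbK.
Qed.

(** Density of a nonempty basic open set: [f * g] times a coordinate vanishes at every vector, the
    coordinate taking care of the excluded vertex 0. *)
Lemma ev_inj_off g f : g != 0 ->
  (forall x, x != 0 -> ev g x != 0 -> ev f x = 0) -> f = 0.
Proof.
move=> g0 fg; have X0 : 'X_ord0 != 0 :> R by rewrite -msupp_eq0 msuppX.
apply: (mulIf (mulf_neq0 g0 X0)); rewrite mul0r; apply: mpoly_eq0_of_eval => v.
pose x : pt := \col_i v i.
have -> q : q.@[v] = ev q x by apply: meval_eq => i; rewrite mxE.
rewrite !evM; have [->|gx] := eqVneq (ev g x) 0; first by rewrite mul0r mulr0.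
rewrite evX; have [->|xi] := eqVneq (x ord0 0) 0; first by rewrite !mulr0.
by rewrite fg ?mul0r //; apply/pt_neq0P; exists ord0.
Qed.

Lemma ev_exists g : g != 0 -> exists2 x, x != 0 & ev g x != 0.
Proof.
move=> g0; apply: NNPP => nex; have /eqP := oner_neq0 R; apply.
apply: (ev_inj_off g0) => x x0 gx; case: nex.
by exists x.
Qed.

Definition basic g : pt -> Prop := fun x => x != 0 /\ ev g x != 0.

Lemma zopen_basic n g : g \is n.-homog -> zopen (basic g).
Proof.
move=> hg; exists (fun f => f = g); split=> [_ ->|x]; first by exists n.
split=> [[x0 gx]|[x0 [_ -> gx]]]; last by [].
by split=> //; exists g.
Qed.

Lemma zopen_neq0 U x : zopen U -> U x -> x != 0.
Proof. by case=> S [_ US] /US[]. Qed.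

Lemma zopen_refine U p : zopen U -> U p -> exists n g,
  [/\ g \is n.-homog, ev g p != 0 & forall x, basic g x -> U x].
Proof.
case=> S [Shom US] /US[p0 [g Sg gp]]; have [n hg] := Shom g Sg.
exists n, g; split=> // x [x0 gx]; apply/US; split=> //.
by exists g.
Qed.

Lemma onbhd_basic U p n g : p != 0 -> g \is n.-homog -> ev g p != 0 ->
  (forall x, basic g x -> U x) -> onbhd U p (basic g).
Proof. by move=> p0 hg gp gU; split=> //; apply: zopen_basic hg. Qed.

(** The fraction is valid on the whole locus where its own denominator is nonzero, so no separate
    neighbourhood has to be carried along. Multiplying numerator and denominator by a suitable form
    brings any local presentation to this shape. *)
Definition frac_at (d : int) U (f : pt -> k) p : Prop :=
  exists (m n : nat) (a b : R),
  [/\ a \is m.-homog, b \is n.-homog, m%:Z = n%:Z + d, ev b p != 0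
    & forall x, basic b x -> U x /\ f x = ev a x / ev b x].

Lemma Osec_frac d U (f : pt -> k) p : Osec d U f -> U p -> frac_at d U f p.
Proof.
move=> fU Up; have [V [oV Vp VU] [m [n [a [b [ha hb e ab]]]]]] := fU p Up.
have [l [g [hg gp gV]]] := zopen_refine oV Vp.
exists (m + l)%N, (n + l)%N, (a * g), (b * g); split.
- exact: dhomogM.
- exact: dhomogM.
- by rewrite !PoszD -e; ring.
- by rewrite evM mulf_neq0 //; case: (ab p Vp).
move=> x [x0]; rewrite !evM mulf_eq0 negb_or => /andP[bx gx].
have Vx : V x by apply: gV.
split; first exact: VU.
by have [_ ->] := ab x Vx; rewrite -mulf_div divff // mulr1.
Qed.

Lemma frac_Osec d U (f : pt -> k) : (forall p, U p -> p != 0) ->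
  (forall p, U p -> frac_at d U f p) -> Osec d U f.
Proof.
move=> U0 fU p Up; have [m [n [a [b [ha hb e bp ab]]]]] := fU p Up.
exists (basic b); first by apply: (onbhd_basic (U0 p Up) hb bp) => x /ab[].
exists m, n, a, b; split=> //; first by rewrite e addrC addKr.
by move=> x bx; split; [case: bx|case: (ab x bx)].
Qed.

Lemma Osec_ext d U (f g : pt -> k) : (forall x, U x -> f x = g x) -> Osec d U f -> Osec d U g.
Proof.
move=> fg fU p Up; have [V [oV Vp VU] [m [n [a [b [ha hb e ab]]]]]] := fU p Up.
exists V => //; exists m, n, a, b; split=> // x Vx.
by have [bx <-] := ab x Vx; rewrite fg //; apply: VU.
Qed.

Lemma Osec_basic d m n a b : a \is m.-homog -> b \is n.-homog ->
  m%:Z = n%:Z + d -> Osec d (basic b) (fun x => ev a x / ev b x).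
Proof.
move=> ha hb e; apply: frac_Osec => [p []//|p [p0 bp]].
by exists m, n, a, b; split.
Qed.

(* Near [p], [s] agrees with [A / b] modulo the Euler vector field, where the
   column [A] has entries of degree [deg b + d] and satisfies [K]. *)
Definition rep_at (K : 'cV[R]_4 -> Prop) (d : int) U (s : pt -> pt) p : Prop :=
  exists (m n : nat) (A : 'cV[R]_4) (b : R),
  [/\ forall i, A i 0 \is m.-homog, b \is n.-homog, m%:Z = n%:Z + d, ev b p != 0
    & K A /\ forall x, basic b x ->
        U x /\ exists c, s x - (ev b x)^-1 *: evmx x A = c *: x].

(** Two cases occur: K all of R^4, where [rep_at K (l + 1)] describes sections of TP^3(l), and K the
    syzygies, which describes the twisted distribution. *)
Definition submodule (K : 'cV[R]_4 -> Prop) :=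
  K 0 /\ forall f A B, K A -> K B -> K (f *: A + B).

Section Rep.
Variable K : 'cV[R]_4 -> Prop.
Hypothesis Klin : submodule K.
Local Notation rep_at := (rep_at K).

Let KZ f A : K A -> K (f *: A).
Proof. by move=> KA; rewrite -[_ *: _]addr0; apply: (proj2 Klin) => //; case: Klin. Qed.

Let KD A B : K A -> K B -> K (A + B).
Proof. by move=> KA KB; rewrite -[A]scale1r; apply: (proj2 Klin). Qed.

Lemma rep_ext d U s t p : Teq U s t -> rep_at d U s p -> rep_at d U t p.
Proof.
move=> st [m [n [A [b [hA hb e bp [KA sA]]]]]]; exists m, n, A, b; split=> //; split=> // x bx.
have [Ux [c sc]] := sA x bx; have [c' tc] := st x Ux.
split=> //; exists (c - c'); rewrite scalerBl -sc -tc.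
by rewrite opprB [RHS]addrC subrKA.
Qed.

Lemma rep_mono d U V s p : (forall x, V x -> U x) -> rep_at d V s p -> rep_at d U s p.
Proof.
move=> VU [m [n [A [b [hA hb e bp [KA sA]]]]]]; exists m, n, A, b; split=> //; split=> // x bx.
by have [Vx sx] := sA x bx; split=> //; apply: VU.
Qed.

Lemma rep_res d U V s p : zopen V -> V p -> rep_at d U s p -> rep_at d V s p.
Proof.
move=> oV Vp [m [n [A [b [hA hb e bp [KA sA]]]]]].
have [l [g [hg gp gV]]] := zopen_refine oV Vp.
exists (l + m)%N, (l + n)%N, (g *: A), (g * b); split.
- by move=> i; rewrite mxE; apply: dhomogM.
- exact: dhomogM.
- by rewrite !PoszD e addrA.
- by rewrite evM mulf_neq0.
split; first exact: KZ.
move=> x [x0]; rewrite evM mulf_eq0 negb_or => /andP[gx bx].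
split; first exact: gV.
have [_ [c sc]] := sA x (conj x0 bx); exists c; rewrite -sc; congr (_ - _).
by rewrite evmxZ scalerA invfM mulrAC mulVf // mul1r.
Qed.

Lemma rep_zero d U p : zopen U -> U p -> rep_at d U (fun=> 0) p.
Proof.
move=> oU Up; have [l [g [hg gp gU]]] := zopen_refine oU Up.
have /pt_neq0P[i pi] := zopen_neq0 oU Up.
(* The numerator degree, denominator degree plus d, must be nonnegative even if d is negative; the
   factor ['X_i ^+ N] in the denominator ensures this. *)
pose N := absz d.
exists (absz ((l + N)%:Z + d)%R), (l + N)%N, 0, (g * 'X_i ^+ N); split.
- by move=> j; rewrite mxE dhomog0.
- exact: dhomogM hg (dhomogXn _ _ _).
- by rewrite /N; lia.
- by rewrite evM evXn evX mulf_neq0 // expf_neq0.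
split; first by case: Klin.
move=> x [x0]; rewrite evM mulf_eq0 negb_or => /andP[gx _].
split; first exact: gU.
by exists 0; rewrite evmx0 scaler0 subr0 scale0r.
Qed.

Lemma rep_add d U s t p : rep_at d U s p -> rep_at d U t p ->
  rep_at d U (fun x => s x + t x) p.
Proof.
move=> [m [n [A [b [hA hb e bp [KA sA]]]]]] [m' [n' [A' [b' [hA' hb' e' bp' [KA' tA]]]]]].
exists (n' + m)%N, (n' + n)%N, (b' *: A + b *: A'), (b' * b); split.
- move=> i; rewrite !mxE; apply: dhomogD; first exact: dhomogM.
  by rewrite (_ : n' + m = n + m')%N; [apply: dhomogM|lia].
- exact: dhomogM.
- by rewrite !PoszD e addrA.
- by rewrite evM mulf_neq0.
split; first by apply: KD; apply: KZ.
move=> x [x0]; rewrite evM mulf_eq0 negb_or => /andP[b'x bx].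
have [Ux [c sc]] := sA x (conj x0 bx); have [_ [c' tc]] := tA x (conj x0 b'x).
split=> //; exists (c + c'); rewrite scalerDl -sc -tc.
have e1 : (ev b' x * ev b x)^-1 * ev b' x = (ev b x)^-1.
  by rewrite invfM mulrAC mulVf ?mul1r.
have e2 : (ev b' x * ev b x)^-1 * ev b x = (ev b' x)^-1.
  by rewrite invfM -mulrA mulVf ?mulr1.
by rewrite evmxD !evmxZ scalerDr !scalerA e1 e2 opprD addrACA.
Qed.

Lemma rep_scale d e U V (f : pt -> k) s p : frac_at e V f p -> rep_at d U s p ->
  rep_at (d + e) U (fun x => f x *: s x) p.
Proof.
move=> [m' [n' [a' [b' [ha' hb' e' bp' fa]]]]] [m [n [A [b [hA hb eA bp [KA sA]]]]]].
exists (m' + m)%N, (n' + n)%N, (a' *: A), (b' * b); split.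
- by move=> i; rewrite mxE; apply: dhomogM.
- exact: dhomogM.
- by lia.
- by rewrite evM mulf_neq0.
split; first exact: KZ.
move=> x [x0]; rewrite evM mulf_eq0 negb_or => /andP[b'x bx].
have [Ux [c sc]] := sA x (conj x0 bx); have [_ ->] := fa x (conj x0 b'x).
split=> //; exists (ev a' x / ev b' x * c); rewrite -[RHS]scalerA -sc scalerBr.
by congr (_ - _); rewrite evmxZ !scalerA invfM; congr (_ *: _); ring.
Qed.

Lemma rep_lincomb d e U n (f : 'I_n -> pt -> k) (s : 'I_n -> pt -> pt) p :
  zopen U -> U p ->
  (forall i, frac_at e U (f i) p) -> (forall i, rep_at d U (s i) p) ->
  rep_at (d + e) U (lincomb f s) p.
Proof.
move=> oU Up hf hs.
suff gen (r : seq 'I_n) : rep_at (d + e) U (fun x => \sum_(i <- r) f i x *: s i x) p.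
  by apply: rep_ext (gen (index_enum _)) => x _; exists 0; rewrite subrr scale0r.
elim: r => [|i r IH].
  apply: rep_ext (rep_zero _ oU Up) => x _.
  by exists 0; rewrite big_nil subrr scale0r.
apply: rep_ext (rep_add (rep_scale (hf i) (hs i)) IH) => x _.
by exists 0; rewrite big_cons subrr scale0r.
Qed.

Lemma rep_nbhd d U s p : p != 0 -> rep_at d U s p ->
  exists2 V, onbhd U p V & forall q, V q -> rep_at d V s q.
Proof.
move=> p0 [m [n [A [b [hA hb e bp [KA sA]]]]]]; exists (basic b).
  by apply: (onbhd_basic p0 hb bp) => x /sA[].
move=> q [q0 bq]; exists m, n, A, b; split=> //; split=> // x bx.
by have [_] := sA x bx.
Qed.

End Rep.

(** The entries of [w] come with different denominators. Writing [w] as a combination of the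
    constant unit vectors, each presented as [g *: delta_mx i 0] over [g], leaves the common
    denominator to [rep_lincomb]. *)
Lemma O4sec_rep d U w p : zopen U -> U p -> O4sec d U w -> rep_at (fun=> True) d U w p.
Proof.
move=> oU Up hw; have trivlin : submodule (fun=> True) by [].
pose s (i : 'I_4) : pt -> pt := fun=> delta_mx i 0.
have hs i : rep_at (fun=> True) 0 U (s i) p.
  have [l [g [hg gp gU]]] := zopen_refine oU Up.
  exists l, l, (g *: delta_mx i 0), g; split=> //.
  - move=> j; rewrite !mxE; case: eqP => _; rewrite ?mulr1 ?mulr0 //; exact: dhomog0.
  - by rewrite addr0.
  split=> // x [x0 gx]; split; first exact: gU.
  exists 0; rewrite evmxZ scalerA mulVf // scale1r scale0r; apply/eqP; rewrite subr_eq0.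
  apply/eqP/matrixP => a b; rewrite evmxE !mxE /= ; case: eqP => _;
    by rewrite ?andbF ?ord1 ?eqxx /= ?ev1 ?ev0.
rewrite -[d]add0r.
apply: rep_ext (rep_lincomb trivlin oU Up (fun i => Osec_frac (hw i) Up) hs) => x _.
exists 0; rewrite scale0r; apply/eqP; rewrite subr_eq0; apply/eqP.
by rewrite /lincomb [RHS]matrix_sum_delta; apply: eq_bigr => i _; rewrite big_ord1.
Qed.

Lemma Tsec_rep l U s p : Tsec l U s -> U p -> rep_at (fun=> True) (l + 1) U s p.
Proof.
move=> hs Up; have [V [oV Vp VU] [w hw sw]] := hs p Up.
apply: (rep_mono VU); apply: rep_ext (O4sec_rep oV Vp hw) => x /sw[c e].
by exists (- c); rewrite scaleNr -e opprB.
Qed.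

Lemma rep_Tsec K l U s : (forall p, U p -> p != 0) ->
  (forall p, U p -> rep_at K (l + 1) U s p) -> Tsec l U s.
Proof.
move=> U0 hs p Up; have [m [n [A [b [hA hb e bp [_ sA]]]]]] := hs p Up.
exists (basic b); first by apply: (onbhd_basic (U0 p Up) hb bp) => x /sA[].
exists (fun x => (ev b x)^-1 *: evmx x A) => [i|x /sA[]//].
apply: Osec_ext (Osec_basic (hA i) hb e) => x _.
by rewrite mxE evmxE mulrC.
Qed.

End Charts.

(** * The syzygy sheaf *)

Section SyzygySheaf.
Variables (k : closedFieldType) (d : 'I_2 -> nat).
Local Notation R := {mpoly k[4]}.
Local Notation pt := 'cV[k]_4.
Variable Theta : 'M[R]_(2, 4).
Hypothesis Theta_homog : forall i j, Theta i j \is (d i).-homog.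
Let h := Theta *m euler k.
Hypothesis h0_neq0 : h 0 0 != 0.
Hypothesis h_regular : forall r,
  (exists q, h 1 0 * r = q * h 0 0) -> exists q, r = q * h 0 0.
Implicit Types (U V W : pt -> Prop) (x p : pt) (s t : pt -> pt) (A : 'cV[R]_4).

Definition syz A : Prop := Theta *m A = 0.

Lemma syz_lin : submodule syz.
Proof.
split=> [|f A B KA KB]; first by rewrite /syz mulmx0.
by rewrite /syz mulmxDr -scalemxAr KA KB scaler0 addr0.
Qed.

(** The image of K(1) in TP^3, the 1 being the twist of O(1)^4. Membership is tested point by point,
    so gluing is immediate. *)
Definition syz_sheaf U s : Prop := forall p, U p -> rep_at syz 1 U s p.

Lemma Teq_sym U s t : Teq U s t -> Teq U t s.
Proof. by move=> st x /st[c e]; exists (- c); rewrite scaleNr -e opprB. Qed.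

Lemma syz_subsheaf : subsheaf syz_sheaf.
Proof.
split.
- move=> U s oU Fs; apply: (@rep_Tsec _ syz) => [p|]; first exact: zopen_neq0.
  by rewrite add0r.
- by move=> U s t _ Fs st p Up; apply: rep_ext st (Fs p Up).
- by move=> U oU p Up; apply: rep_zero => //; apply: syz_lin.
- by move=> U s t _ Fs Ft p Up; apply: rep_add (Fs p Up) (Ft p Up); apply: syz_lin.
- move=> U f s _ hf Fs p Up; rewrite -[1]addr0.
  by apply: rep_scale (Osec_frac hf Up) (Fs p Up); apply: syz_lin.
- move=> U V s _ oV VU Fs p Vp.
  by apply: (rep_res syz_lin oV Vp (Fs p (VU p Vp))).
- move=> U s _ loc p Up; have [V [oV Vp VU] FV] := loc p Up.
  exact: rep_mono VU (FV p Vp).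
Qed.

Lemma syz_sheaf_nbhd U s p : p != 0 -> rep_at syz 1 U s p ->
  exists2 V, onbhd U p V & syz_sheaf V s.
Proof. exact: rep_nbhd. Qed.

Lemma rep_basic A b m n (e : int) p :
  (forall i, A i 0 \is m.-homog) -> b \is n.-homog -> m%:Z = n%:Z + e -> syz A ->
  basic b p -> rep_at syz e (basic b) (fun x => (ev b x)^-1 *: evmx x A) p.
Proof.
move=> hA hb he KA [p0 bp]; exists m, n, A, b; split=> //; split=> // x bx.
by split=> //; exists 0; rewrite subrr scale0r.
Qed.

Lemma syz_eval x A : syz A -> evmx x Theta *m evmx x A = 0.
Proof. by move=> KA; rewrite -evmxM KA evmx0. Qed.

(** The first row of Theta sends c x to c h_1(x), which forces c = 0. *)
Lemma ker_euler x (v : pt) c : evmx x Theta *m v = 0 -> v = c *: x ->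
  ev (h 0 0) x != 0 -> v = 0.
Proof.
move=> Kv vE hx; suff c0 : c = 0 by rewrite vE c0 scale0r.
apply: (mulIf hx); rewrite mul0r -evmxE evmxM evmx_euler.
by have /matrixP/(_ 0 0) := Kv; rewrite vE -scalemxAr mxE => ->; rewrite mxE.
Qed.

(** The two fractions differ at each point by a multiple of x that Theta kills; [ker_euler] makes it
    zero off h_1 = 0, and density gives the polynomial identity. *)
Lemma rep_unique s A A' b b' : syz A -> syz A' -> b != 0 -> b' != 0 ->
  (forall x, basic b x -> exists c, s x - (ev b x)^-1 *: evmx x A = c *: x) ->
  (forall x, basic b' x -> exists c, s x - (ev b' x)^-1 *: evmx x A' = c *: x) ->
  b' *: A = b *: A'.
Proof.
move=> KA KA' b0 b'0 sA sA'; apply/eqP; rewrite -subr_eq0; apply/eqP/matrixP => i j.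
rewrite (ord1 j) [RHS]mxE.
apply: (ev_inj_off (mulf_neq0 (mulf_neq0 b0 b'0) h0_neq0)) => x x0.
rewrite !evM !mulf_eq0 !negb_or => /andP[/andP[bx b'x] hx].
have [c sc] := sA x (conj x0 bx); have [c' sc'] := sA' x (conj x0 b'x).
pose v := (ev b x)^-1 *: evmx x A - (ev b' x)^-1 *: evmx x A'.
have v0 : v = 0.
  apply: (@ker_euler x _ (c' - c)) => //.
    by rewrite /v mulmxBr -!scalemxAr !syz_eval // !scaler0 subrr.
  by rewrite scalerBl -sc -sc' /v [RHS]addrC opprB subrKA.
have -> : ev ((b' *: A - b *: A') i 0) x = ev b x * ev b' x * v i 0.
  by rewrite !mxE evB !evM; field; apply/andP.
by rewrite v0 mxE mulr0.
Qed.

(** * Torsion-freeness of the quotient *)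

Lemma syz_torsion_free : torsion_free_quotient syz_sheaf.
Proof.
move=> p U s f oU Up Ts Of fn0 [V [oV Vp VU] Fs].
have p0 := zopen_neq0 oU Up.
have [m [n [A [b [hA hb eA bp [_ sA]]]]]] := Tsec_rep Ts Up.
have [m2 [n2 [a [e [ha he e2 ep fa]]]]] := Osec_frac Of Up.
have [m3 [n3 [A' [b' [_ _ _ b'p [KA' sA']]]]]] := Fs p Vp.
have nz g : ev g p != 0 -> g != 0 by apply: contraNneq => ->; rewrite ev0.
have a0 : a != 0.
  apply/negP => /eqP a0; apply: fn0; exists (basic e).
    by apply: (onbhd_basic p0 he ep) => x /fa[].
  by move=> x /fa[_ ->]; rewrite a0 ev0 mul0r.
pose y := Theta *m A.
have yh : h 1 0 * y 0 0 = y 1 0 * h 0 0.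
  apply/eqP; rewrite -subr_eq0; apply/eqP.
  apply: (ev_inj_off (mulf_neq0 (mulf_neq0 a0 (nz _ bp)) (mulf_neq0 (nz _ ep) (nz _ b'p)))).
  move=> x x0; rewrite !evM !mulf_eq0 !negb_or => /andP[/andP[ax bx] /andP[ex b'x]].
  have [_ [c sc]] := sA x (conj x0 bx).
  have [_ fx] := fa x (conj x0 ex).
  have [_ [c' sc']] := sA' x (conj x0 b'x).
  pose u := ev a x / ev e x / ev b x.
  pose q := c' - f x * c.
  (* With s = A / b, f = a / e and f s = A' / b' modulo x, the vector u A(x) - q x is exactly the
     value of A' / b', which Theta(x) kills. As u is nonzero, Theta A and h are proportional at
     x. *)
  have E : u *: evmx x y = q *: evmx x h.
    rewrite /y /h !evmxM evmx_euler !scalemxAr.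
    apply/eqP; rewrite -subr_eq0 -mulmxBr.
    have -> : u *: evmx x A - q *: x = (ev b' x)^-1 *: evmx x A'.
      rewrite /q scalerBl -(scalerA _ c) -sc -sc' fx /u scalerBr -scalerA.
      by rewrite opprB addrC addrAC subrK opprB addrC subrK.
    by rewrite -scalemxAr syz_eval // scaler0.
  have u0 : u != 0 by rewrite /u !mulf_neq0 ?invr_eq0.
  have E0 : u * ev (y 0 0) x = q * ev (h 0 0) x.
    by have /matrixP/(_ 0 0) := E; rewrite [LHS]mxE [RHS]mxE !evmxE.
  have E1 : u * ev (y 1 0) x = q * ev (h 1 0) x.
    by have /matrixP/(_ 1 0) := E; rewrite [LHS]mxE [RHS]mxE !evmxE.
  apply: (mulfI u0); rewrite evB !evM mulr0 mulrBr.
  by rewrite mulrCA E0 [u * (_ * _)]mulrA E1; ring.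
have [|q yq] := h_regular (r := y 0 0); first by exists (y 1 0).
have yE : y = q *: h.
  apply/matrixP => i j; rewrite (ord1 j) [RHS]mxE.
  have [->|->] := ord2P i.
    exact: yq.
  by apply: (mulIf h0_neq0); rewrite -yh yq; ring.
have hh : h 0 0 \is (d 0 + 1).-homog.
  rewrite mxE; apply: rpred_sum => i _; apply: dhomogM => //.
  by rewrite mxE; apply: dhomogXU.
have hy : q * h 0 0 \is (d 0 + m).-homog.
  by rewrite -yq mxE; apply: rpred_sum => i _; apply: dhomogM.
pose A2 := A - q *: euler k.
have KA2 : syz A2 by rewrite /syz mulmxBr -scalemxAr -/y -/h yE subrr.
(* Comparing degrees in y_1 = q h_1 shows that [q] is zero or homogeneous of degree m - 1, so
   subtracting [q *: euler k] keeps the degree of [A]. *)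
have hA2 i : A2 i 0 \is m.-homog.
  rewrite !mxE; have [[le hq]|->] := dhomog_factor h0_neq0 hh hy; last first.
    by rewrite mul0r subr0.
  rewrite leq_add2l in le; rewrite subnDl in hq.
  apply: rpredB => //; rewrite -(subnK le).
  exact: dhomogM hq (dhomogXU _ _).
apply: syz_sheaf_nbhd => //; exists m, n, A2, b; split=> //.
split=> // x bx; have [Ux [c sc]] := sA x bx; split=> //.
exists (c + (ev b x)^-1 * ev q x).
rewrite scalerDl -sc evmxB evmxZ evmx_euler scalerBr scalerA.
by rewrite opprB addrA addrAC.
Qed.

(** * Coherence by dehomogenization on the coordinate charts *)

Lemma dehomogenize_eval (i : 'I_4) N (A : 'cV[R]_4) x :
  (forall l, (msize (A l 0%R) <= N.+1)%N) -> x i 0 != 0 ->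
  evmx x (\col_l homogenize i N (A l 0)) = x i 0 ^+ N *: evmx ((x i 0)^-1 *: x) A.
Proof.
move=> AN xi; apply/matrixP => l j; rewrite (ord1 j) evmxE !mxE.
rewrite /ev homogenize_eval //; congr (_ * _).
by apply: meval_eq => r; rewrite mxE.
Qed.

(** Off x_i = 0 put y = x / x_i: row r of Theta(x) is x_i^(d_r) times row r of Theta(y), and the new
    column at x is x_i^N A(y), so each product is a multiple of a row of Theta(y) A(y) = 0. *)
Lemma syz_homogenize (i : 'I_4) N A : (forall l, (msize (A l 0%R) <= N.+1)%N) ->
  syz A -> syz (\col_l homogenize i N (A l 0)).
Proof.
move=> AN KA; apply/matrixP => r j; rewrite (ord1 j) [RHS]mxE.
have Xi : 'X_i != 0 :> R by rewrite -msupp_eq0 msuppX.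
apply: (ev_inj_off Xi) => x x0; rewrite evX => xi.
rewrite -evmxE evmxM dehomogenize_eval // -scalemxAr mxE.
have xE : x = x i 0 *: ((x i 0)^-1 *: x) by rewrite scalerA divff // scale1r.
set y := _^-1 *: x in xE *.
suff -> : (evmx x Theta *m evmx y A) r 0 = x i 0 ^+ d r * (evmx y Theta *m evmx y A) r 0.
  by rewrite syz_eval // !mxE !mulr0.
rewrite [LHS]mxE [in RHS]mxE mulr_sumr; apply: eq_bigr => l _.
by rewrite !evmxE mulrA; congr (_ * _); rewrite {1}xE (ev_homog _ _ (Theta_homog r l)).
Qed.

(** The bound on degrees is N + 1, hence positive: a power of ['X_i] with that exponent vanishes
    exactly where ['X_i] does. *)
Lemma msize_bound (I J : finType) (F : I -> J -> R) :
  exists N, forall i j, (msize (F i j) <= N.+2)%N.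
Proof.
exists (\max_i \max_j msize (F i j)) => i j; do 2 apply: leqW.
by apply: leq_trans (leq_bigmax i); apply: leq_trans (leq_bigmax j).
Qed.

Lemma syz_coherent : coherent syz_sheaf.
Proof.
move=> p p0; have /pt_neq0P[i pi] := p0.
have [g gK gP] := @submodule_fg k 4 4 syz (fun a u v => (proj2 syz_lin a u v)).
have [N gN] := msize_bound (fun (j : 'I_(size g)) (l : 'I_4) => g`_j l 0).
exists (basic 'X_i); first by apply: (onbhd_basic p0 (dhomogXU k i)) => [|x []//]; rewrite evX.
(* Dehomogenized generators, rescaled by x_i to have degree 1 as sections of K(1) require. *)
pose S (j : 'I_(size g)) x := x i 0 *: evmx ((x i 0)^-1 *: x) g`_j.
have Kg (j : 'I_(size g)) : syz g`_j by apply: gK; apply: mem_nth.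
have XE n x : basic ('X_i ^+ n.+1) x -> basic 'X_i x.
  by case=> x0; rewrite evXn expf_eq0 /= => xi; split.
exists (size g), S; split.
  move=> j q [q0 qi].
  pose A := 'X_i *: \col_l homogenize i N.+1 (g`_j l 0).
  have := @rep_basic A ('X_i ^+ N.+1) N.+2 N.+1 1 q.
  move=> /(_ _ (dhomogXn _ _ _)) rb; apply: rep_mono (XE N) _.
  apply: rep_ext (rb _ _ _ _).
  - move=> x [x0]; rewrite evXn expf_eq0 /= evX => xi; exists 0; rewrite scale0r.
    rewrite evmxZ dehomogenize_eval // scalerA scalerA mulrCA mulVf ?expf_neq0 ?evX // mulr1.
    by rewrite subrr.
  - move=> l; rewrite !mxE -[N.+2]add1n; apply: dhomogM; first exact: dhomogXU.
    exact: homogenize_homog.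
  - by rewrite -addn1 PoszD.
  - by rewrite /A -[_ *: _]addr0; apply: (proj2 syz_lin); [apply: syz_homogenize|case: syz_lin].
  - by split=> //; rewrite evXn expf_neq0.
move=> W t oW WV Ft q Wq.
have q0 := zopen_neq0 oW Wq; have [_ qi] := WV q Wq; rewrite evX in qi.
have [m [n [A [b [hA hb eA bq [KA tA]]]]]] := Ft q Wq.
have [c cA] := gP A KA.
have [M cM] := msize_bound (fun (j : 'I_(size g)) (_ : 'I_1) => c j).
pose D := 'X_i ^+ M.+1 * b.
have hD : D \is (M.+1 + n).-homog by apply: dhomogM hb; apply: dhomogXn.
exists (basic D).
  apply: (onbhd_basic q0 hD) => [|x [x0]].
    by rewrite evM evXn evX mulf_neq0 // expf_neq0.
  by rewrite evM mulf_eq0 negb_or => /andP[_ bx]; case: (tA x).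
(* Over [D] this is c_j(x / x_i) x_i^n / b(x). Since A = sum of c_j g_j has degree n + 1, one factor
   x_i remains for [S j]. *)
pose a j := homogenize i M.+1 (c j) * 'X_i ^+ n.
have ha j : a j \is (M.+1 + n).-homog.
  by apply: dhomogM (dhomogXn _ _ _); apply: homogenize_homog; apply: (cM j 0).
exists (fun j x => ev (a j) x / ev D x); split.
  by move=> j; apply: Osec_basic (ha j) hD _; rewrite addr0.
move=> x [x0]; rewrite evM mulf_eq0 negb_or evXn evX expf_eq0 /= => /andP[xi bx].
have [_ [e te]] := tA x (conj x0 bx); exists e; rewrite -te; congr (_ - _).
have xE : x = x i 0 *: ((x i 0)^-1 *: x) by rewrite scalerA divff // scale1r.
rewrite /lincomb /S; set y := _^-1 *: x in xE *.
have -> : evmx x A = x i 0 ^+ m *: evmx y A.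
  by apply/matrixP => l j; rewrite !mxE (ord1 j) -/(ev _ _) {1}xE (ev_homog _ _ (hA l)).
have -> : m = n.+1 by clear -eA; lia.
rewrite cA /evmx raddf_sum /= !scaler_sumr; apply: eq_bigr => j _.
rewrite map_mxZ /= !scalerA -/(ev (c j) y); congr (_ *: _).
have aE : ev (a j) x = x i 0 ^+ M.+1 * ev (c j) y * x i 0 ^+ n.
  rewrite evM evXn evX {1}/ev homogenize_eval ?(cM j 0) //; congr (_ * _ * _).
  by apply: meval_eq => l; rewrite mxE.
rewrite aE /D evM evXn evX !exprSr; field.
by rewrite bx xi expf_neq0.
Qed.

(** * Generic rank, from the 2 x 2 minors *)

Definition minor2 (i j : 'I_4) : R := Theta 0 i * Theta 1 j - Theta 0 j * Theta 1 i.

(** Since h_1 is nonzero, some entry [Theta 0 j] is nonzero. If all minors vanished, [Theta 1 j]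
    times the first row minus [Theta 0 j] times the second would be a nontrivial relation between
    the rows. *)
Lemma rank2_minor2 :
  \rank (map_mx (@FracField.tofrac R) Theta) = 2%N -> exists i j, minor2 i j != 0.
Proof.
move=> rk; have [j Tj] : exists j, Theta 0 j != 0.
  apply/existsP; apply: contraNT h0_neq0; rewrite negb_exists => /forallP T0.
  by rewrite mxE big1 // => j _; move/eqP: (negbNE (T0 j)) => ->; rewrite mul0r.
apply: NNPP => no; pose M := map_mx (@FracField.tofrac R) Theta.
have free : row_free M by rewrite /row_free rk.
pose u : 'rV_2 := \row_r FracField.tofrac (if r == 0 then Theta 1 j else - Theta 0 j).
have : u *m M == 0.
  apply/eqP/matrixP => a l; rewrite mxE big_ord_recl big_ord1 !mxE /= -!rmorphM -rmorphD.
  apply/eqP; rewrite tofrac_eq0; apply: contra_notT no => nz; exists l, j.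
  apply: contraNneq nz => m0; rewrite -[X in _ == X]m0 /minor2.
  by apply/eqP; rewrite (_ : lift _ _ = 1); [ring|apply: val_inj].
rewrite mulmx_free_eq0 // => /eqP/matrixP/(_ 0 1)/eqP.
by rewrite !mxE /= tofrac_eq0 oppr_eq0 (negPf Tj).
Qed.

Local Notation unitv l := (delta_mx l 0 : 'cV[R]_4).

(* Syzygies given by the three-term Plucker relation; they span ker Theta
   wherever [minor2 i j] is invertible. *)
Definition cramer (i j l : 'I_4) : 'cV[R]_4 :=
  minor2 i j *: unitv l + minor2 j l *: unitv i + minor2 l i *: unitv j.

Lemma minor2_homog i j : minor2 i j \is (d 0 + d 1).-homog.
Proof. by apply: rpredB; apply: dhomogM. Qed.

Lemma cramer_homog i j l r : cramer i j l r 0 \is (d 0 + d 1).-homog.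
Proof.
have dl (f : R) (c : bool) : f \is (d 0 + d 1).-homog -> f * c%:R \is (d 0 + d 1).-homog.
  by move=> hf; case: c; rewrite ?mulr1 ?mulr0 // dhomog0.
by rewrite !mxE; do ![apply: rpredD]; apply/dl/minor2_homog.
Qed.

Lemma cramer_syz i j l : syz (cramer i j l).
Proof.
have colTheta q : Theta *m unitv q = col q Theta by rewrite -colE.
apply/matrixP => r c; rewrite (ord1 c) /cramer !mulmxDr -!scalemxAr !colTheta.
have colE q : (col q Theta) r 0 = Theta r q by rewrite mxE.
rewrite [LHS]mxE [in LHS]mxE [X in X + _ + _]mxE [X in _ + X + _]mxE [X in _ + X]mxE !colE [RHS]mxE.
rewrite /minor2; have [rE|rE] := ord2P r.
- by rewrite rE; ring.
- by rewrite rE; ring.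
Qed.

(** The extra coefficients of the unit vectors i and j are combinations of the two row equations of
    Theta A = 0, so they vanish. *)
Lemma cramer_span i j A : syz A -> \sum_l A l 0 *: cramer i j l = minor2 i j *: A.
Proof.
move=> KA; have rowE (r : 'I_2) : \sum_l Theta r l * A l 0 = 0.
  by have /matrixP/(_ r 0) := KA; rewrite mxE => ->; rewrite mxE.
have s1 : \sum_l A l 0 * minor2 j l = 0.
  transitivity (Theta 0 j * (\sum_l Theta 1 l * A l 0) - Theta 1 j * (\sum_l Theta 0 l * A l 0)).
    rewrite !mulr_sumr -sumrB; apply: eq_bigr => l _; rewrite /minor2; ring.
  by rewrite !rowE !mulr0 subr0.
have s2 : \sum_l A l 0 * minor2 l i = 0.
  transitivity (Theta 1 i * (\sum_l Theta 0 l * A l 0) - Theta 0 i * (\sum_l Theta 1 l * A l 0)).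
    rewrite !mulr_sumr -sumrB; apply: eq_bigr => l _; rewrite /minor2; ring.
  by rewrite !rowE !mulr0 subr0.
transitivity (\sum_l A l 0 *: (minor2 i j *: unitv l) +
    (\sum_l A l 0 * minor2 j l) *: unitv i + (\sum_l A l 0 * minor2 l i) *: unitv j).
  rewrite !scaler_suml -!big_split; apply: eq_bigr => l _ /=.
  by rewrite /cramer !scalerDr !scalerA.
rewrite s1 s2 !scale0r !addr0 [in RHS](matrix_sum_delta A) scaler_sumr.
by apply: eq_bigr => l _; rewrite big_ord1 !scalerA mulrC.
Qed.

Lemma cramer_eq0 i j : cramer i j i = 0 /\ cramer i j j = 0.
Proof.
have m0 q : minor2 q q = 0 by rewrite /minor2 mulrC subrr.
have mN : minor2 j i = - minor2 i j by rewrite /minor2 opprB.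
by split; rewrite /cramer !m0 mN !scale0r scaleNr !addr0 addrN.
Qed.

Lemma complement2 (i j : 'I_4) : i != j -> exists c : 'I_2 -> 'I_4,
  [/\ forall r s : 'I_2, (c r == c s) = (r == s), forall r, c r != i /\ c r != j
    & forall l, l != i -> l != j -> exists r, l = c r].
Proof.
move=> ij.
have: #|~: [set i; j]| == 2%N.
  by have := cardsC [set i; j]; rewrite cards2 ij card_ord => /eqP; rewrite eqn_add2l.
case/cards2P => a [b [ab e]]; exists (fun r => if r == 0 then a else b).
have inE' l : (l \in [set a; b]) = (l != i) && (l != j) by rewrite -e !inE negb_or.
split=> [r s|r|l li lj].
- by case: (ord2P r) (ord2P s) => -> [] ->; rewrite /= ?eqxx // ?(negPf ab) // eq_sym (negPf ab).
- by apply/andP; rewrite -inE' !inE; case: ifP; rewrite eqxx ?orbT.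
have: l \in [set a; b] by rewrite inE' li.
by rewrite !inE => /orP[] /eqP ->; [exists 0|exists 1].
Qed.

(** The basis consists of the Cramer syzygies for the two columns other than i and j, divided by the
    minor and multiplied by [X] to reach degree 1. On those two coordinates they form [X] times the
    identity, which gives independence; [cramer_span] gives generation. *)
Lemma syz_rank2 i j : minor2 i j != 0 -> has_rank 2 syz_sheaf.
Proof.
move=> dij0; have ij : i != j by apply: contraNneq dij0 => ->; rewrite /minor2 subrr.
have [c [cinj cN cC]] := complement2 ij.
set dij := minor2 i j in dij0 *; pose X : R := 'X_ord0.
have X0 : X != 0 by rewrite /X -msupp_eq0 msuppX.
have hX : X \is 1.-homog by apply: dhomogXU.
have hD : dij \is (d 0 + d 1).-homog by apply: minor2_homog.
pose sec (r : 'I_2) x := (ev dij x)^-1 *: evmx x (X *: cramer i j (c r)).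
pose V := basic (dij * X).
have oV : zopen V by apply: zopen_basic; apply: dhomogM hD hX.
have cramerE (r s : 'I_2) : cramer i j (c r) (c s) 0 = dij * (r == s)%:R.
  have [si sj] := cN s.
  by rewrite /cramer !mxE (negPf si) (negPf sj) cinj !mulr0 !addr0 andbT eq_sym.
have secE (f : 'I_2 -> pt -> k) x (s : 'I_2) : ev dij x != 0 ->
    lincomb f sec x (c s) 0 = f s x * ev X x.
  move=> dx; have entry r : sec r x (c s) 0 = ev X x * (r == s)%:R.
    rewrite /sec mxE evmxE mxE cramerE [X * _]mulrCA !evM mulKf //.
    by case: eqP => _; rewrite ?ev1 ?ev0.
  rewrite /lincomb summxE (bigD1 s) //= big1 => [|r rs].
    by rewrite addr0 mxE entry eqxx mulr1.
  by rewrite mxE entry (negPf rs) !mulr0.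
have secK (f : 'I_2 -> pt -> k) x : evmx x Theta *m lincomb f sec x = 0.
  rewrite /lincomb mulmx_sumr big1 // => r _; rewrite -!scalemxAr syz_eval ?scaler0 //.
  by rewrite /syz -scalemxAr cramer_syz scaler0.
have Vd x : V x -> [/\ x != 0, ev dij x != 0 & ev X x != 0].
  by case=> x0; rewrite evM mulf_eq0 negb_or => /andP[].
exists V, sec; split.
- split=> //; have [p p0 pD] := ev_exists (mulf_neq0 dij0 X0).
  by exists p; split.
- move=> r p Vp; have [p0 pd _] := Vd p Vp.
  apply: (rep_res syz_lin (U := basic dij)) => //.
  apply: (rep_basic (m := 1 + (d 0%R + d 1%R)) (n := d 0 + d 1) (A := X *: cramer i j (c r))) => //.
  + by move=> l; rewrite mxE; apply: dhomogM hX (cramer_homog _ _ _ _).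
  + by rewrite PoszD addrC.
  + by rewrite /syz -scalemxAr cramer_syz scaler0.
- move=> W f oW _ WV Of f0 r p Wp.
  have [m [n [a [b [_ _ _ bp fa]]]]] := Osec_frac (Of r) Wp.
  have b0 : b != 0 by apply: contraNneq bp => ->; rewrite ev0.
  have -> : f r p = ev a p / ev b p by have [] := fa p (conj (zopen_neq0 oW Wp) bp).
  (* The relation holds modulo x only, and [ker_euler] requires h_1(x) nonzero, which may fail at p
     itself; hence the whole numerator is shown to vanish, by density. *)
  suff -> : a = 0 by rewrite ev0 mul0r.
  apply: (ev_inj_off (mulf_neq0 b0 h0_neq0)) => x x0.
  rewrite evM mulf_eq0 negb_or => /andP[bx hx].
  have [Wx fx] := fa x (conj x0 bx); have [_ dx Xx] := Vd x (WV x Wx).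
  have [e] := f0 x Wx; rewrite subr0 => /(ker_euler (secK f x))/(_ hx) l0.
  have := secE f x r dx; rewrite l0 mxE fx => /esym/eqP.
  by rewrite !mulf_eq0 (negPf Xx) invr_eq0 (negPf bx) !orbF => /eqP.
move=> W t oW [p Wp] Ft.
have [m [n [A [b [hA hb eA bp [KA tA]]]]]] := Ft p Wp.
have b0 : b != 0 by apply: contraNneq bp => ->; rewrite ev0.
pose D := dij * X * b.
have hDb : D \is (d 0 + d 1 + 1 + n).-homog by apply: dhomogM hb; apply: dhomogM hD hX.
have Dn x : basic D x -> V x /\ basic b x.
  case=> x0; rewrite evM mulf_eq0 negb_or => /andP[]; by split; split.
exists (basic D), (fun r x => ev (dij * A (c r) 0) x / ev D x); split.
- split; first exact: zopen_basic hDb.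
  have D0 : D != 0 by rewrite !mulf_neq0.
  by have [q q0 qD] := ev_exists D0; exists q.
- by move=> x /Dn[Vx /tA[]].
- by move=> r; apply: Osec_basic (dhomogM hD (hA _)) hDb _; rewrite !PoszD eA; ring.
move=> x /Dn[Vx bx]; have [_ [e te]] := tA x bx; exists e; rewrite -te; congr (_ - _).
have [_ dx Xx] := Vd x Vx; case: bx => _ bx.
have AE : dij *: A = \sum_r A (c r) 0 *: cramer i j (c r).
  rewrite -cramer_span // (bigID (mem (c @: [set: 'I_2]))) /= [X in _ + X]big1 ?addr0 => [|l].
    rewrite big_imset /= => [|r q _ _ /eqP]; last by rewrite cinj => /eqP.
    by apply: eq_bigl => r; rewrite inE.
  have [ki kj] := cramer_eq0 i j; have [->|li] := eqVneq l i; first by rewrite ki scaler0.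
  have [->|lj] := eqVneq l j; first by rewrite kj scaler0.
  by have [r ->] := cC l li lj; rewrite imset_f.
rewrite /lincomb /sec.
have -> : evmx x A = (ev dij x)^-1 *: evmx x (dij *: A).
  by rewrite evmxZ scalerA mulVf ?scale1r.
rewrite AE /evmx raddf_sum !scaler_sumr; apply: eq_bigr => r _ /=.
rewrite !map_mxZ /= !scalerA; congr (_ *: _).
rewrite /D !evM -/(ev X x) -/(ev (A (c r) 0) x); field.
exact/and3P.
Qed.

(** * Global sections of the twists *)

Lemma syz_griso : griso (gshift 1 (Syz Theta)) (Gamma_star syz_sheaf).
Proof.
exists (fun _ v x => evmx x v); split.
- move=> e v [/= Kv hv] p p0; have /pt_neq0P[i pi] := p0.
  (* To exhibit v in F(e), it is written on x_i ≠ 0 as x_i^a / x_i^a' times x_i^a' v / x_i^a, of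
     degrees e = a - a' and 1. Both exponents are positive, so both denominators define the chart
     itself. *)
  pose a' := (absz e).+1; pose a := absz (e + a'%:Z).
  have aE : a%:Z = a'%:Z + e by rewrite /a /a'; clear; lia.
  have a0 : (0 < a)%N by rewrite -ltz_nat aE /a'; clear; lia.
  exists (basic 'X_i); first by apply: (onbhd_basic p0 (dhomogXU k i)) => [|x []//]; rewrite evX.
  exists 1%N, (fun _ x => ev ('X_i ^+ a) x / ev ('X_i ^+ a') x).
  exists (fun _ x => (ev ('X_i ^+ a) x)^-1 *: evmx x ('X_i ^+ a' *: v)).
  have Xpow n x : (0 < n)%N -> basic ('X_i ^+ n) x <-> basic 'X_i x.
    by move=> n0; rewrite /basic evXn expf_eq0 n0.
  split=> [_|_ q qi|x [x0]].
  + apply: frac_Osec => [q []//|q qi].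
    exists a, a', ('X_i ^+ a), ('X_i ^+ a'); split=> //; [exact: dhomogXn|exact: dhomogXn| |].
      by have /(Xpow a' _ (ltn0Sn _))[] := qi.
    by move=> x xb; split=> //; apply/(Xpow a' x (ltn0Sn _)).
  + apply: (rep_mono (V := basic ('X_i ^+ a))) => [x /(Xpow _ _ a0)//|].
    apply: (rep_basic (m := a + 1) (n := a)); [|exact: dhomogXn|by []| |exact/Xpow].
      move=> l; rewrite mxE; have := hv l; case E: (e + 1) => [n|n] /=; last first.
        by move=> ->; rewrite mulr0 dhomog0.
      move=> hn; rewrite (_ : a + 1 = a' + n)%N; first exact: dhomogM (dhomogXn _ _ _) hn.
      by clear -aE E; lia.
    by rewrite /syz -scalemxAr Kv scaler0.
  rewrite evX => xi; exists 0; rewrite scale0r /lincomb big_ord1 evmxZ !scalerA.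
  rewrite !evXn evX [X in _ - X *: _](_ : _ = 1) ?scale1r ?subrr //.
  by field; rewrite !expf_neq0.
- move=> e u v [/= Ku _] [/= Kv _]; split=> [uv|->]; last first.
    by move=> x _; exists 0; rewrite subrr scale0r.
  have := @rep_unique (fun x => evmx x u) u v 1 1 Ku Kv (oner_neq0 _) (oner_neq0 _).
  rewrite !scale1r => ->// x [x0 _]; rewrite ev1 invr1 scale1r.
    by exists 0; rewrite subrr scale0r.
  exact: uv.
- by move=> e u v _ _ x _; exists 0; rewrite /= evmxD subrr scale0r.
- by move=> e n r v _ _ x _; exists 0; rewrite /= evmxZ subrr scale0r.
move=> e; rewrite /= => y ty; rewrite /= in y ty *.
have repy p : p != 0 -> rep_at syz (e + 1) (@whole k) y p.
  move=> p0; have [V [oV Vp VU] [n [g [t [hg ht yl]]]]] := ty p p0.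
  apply: (rep_mono VU); apply: rep_ext (Teq_sym yl) _; rewrite addrC.
  by apply: (rep_lincomb syz_lin) => // r; [apply: Osec_frac|apply: ht].
(* All syzygy presentations of [y], freed from their base points. [Pcov] and [Punique] are the
   covering and compatibility conditions that [hartogs] needs for each coordinate. *)
pose P A b := exists m n, [/\ forall i, A i 0 \is m.-homog, b \is n.-homog, m%:Z = n%:Z + (e + 1),
  b != 0 & syz A /\ forall x, basic b x -> exists c, y x - (ev b x)^-1 *: evmx x A = c *: x].
have Pcov x : x != 0 -> exists A b, P A b /\ ev b x != 0.
  move=> x0; have [m [n [A [b [hA hb eA bx [KA yA]]]]]] := repy x x0.
  exists A, b; split=> //; exists m, n; split=> //.
    by apply: contraNneq bx => ->; rewrite ev0.
  by split=> // z /yA[].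
have Punique A b A' b' : P A b -> P A' b' -> b' *: A = b *: A'.
  move=> [m [n [_ _ _ b0 [KA yA]]]] [m' [n' [_ _ _ b0' [KA' yA']]]].
  exact: (@rep_unique y).
have /fin_all_exists[v vP] (l : 'I_4) : exists f : R, forall A b, P A b -> A l 0 = f * b.
  have := @hartogs k 4 ord0 (fun a b => exists2 A, P A b & a = A l 0).
  case.
  - by exists ord_max.
  - by move=> a b [A [m [n [_ hb _ _ _]]] _]; exists n.
  - move=> a b a' b' [A PA ->] [A' PA' ->].
    by have /matrixP/(_ l 0) := Punique _ _ _ _ PA PA'; rewrite !mxE mulrC [b * _]mulrC.
  - move=> u [j uj]; pose x : pt := \col_r u r.
    have [|A [b [PA bx]]] := Pcov x; first by apply/pt_neq0P; exists j; rewrite mxE.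
    exists (A l 0), b; split; first by exists A.
    by rewrite (meval_eq (v2 := fun r => x r 0)) // => r; rewrite mxE.
  by move=> f fP; exists f => A b PA; apply: fP; exists A.
pose w : 'cV[R]_4 := \col_l v l.
have wE A b : P A b -> A = b *: w.
  by move=> PA; apply/matrixP => l j; rewrite (ord1 j) !mxE mulrC; apply: vP.
have [|A [b [PA _]]] := Pcov (const_mx 1).
  by apply/pt_neq0P; exists ord0; rewrite mxE oner_eq0.
exists w; last first.
  move=> x x0; have [B [q [PB qx]]] := Pcov x x0.
  have [m [n [_ _ _ _ [_ yB]]]] := PB; have [c yc] := yB x (conj x0 qx).
  exists (- c); rewrite scaleNr -yc opprB (wE _ _ PB) evmxZ scalerA mulVf //.
  by rewrite scale1r.
have [m [n [hA hb eA b0 [KA _]]]] := PA; split.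
  rewrite (wE _ _ PA) /syz -scalemxAr in KA.
  apply/matrixP => r j; have /matrixP/(_ r j)/eqP := KA.
  by rewrite !mxE mulf_eq0 (negPf b0) /= => /eqP.
(* The coordinate has degree m - n = e + 1 or is zero; the latter is forced when e + 1 is negative,
   as [homogz] demands. *)
move=> l; have := hA l; rewrite (vP l A b PA) => /(dhomog_factor b0 hb).
rewrite mxE => -[[nm hv]|->]; last by case: (e + 1)%R => // ?; apply: dhomog0.
by rewrite (_ : e + 1 = (m - n)%N%:Z) //; clear -eA nm; lia.
Qed.

End SyzygySheaf.

Theorem theorem4 (k : closedFieldType) (char0 : [pchar k] =i pred0)
    (d1 d2 : nat) (Theta : 'M[{mpoly k[4]}]_(2, 4))
    (rank2 : \rank (map_mx (@FracField.tofrac {mpoly k[4]}) Theta) = 2%N)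
    (hd : (d1 <= d2)%N)
    (homog1 : forall j, Theta 0 j \is d1.-homog)
    (homog2 : forall j, Theta 1 j \is d2.-homog)
    (gcd1 : forall i, gcd_one (fun j => Theta i j))
    (regular : regular_pair ((Theta *m euler k) 0 0) ((Theta *m euler k) 1 0)) :
  exists F : ('cV[k]_4 -> Prop) -> ('cV[k]_4 -> 'cV[k]_4) -> Prop,
    codim1_distribution F /\ griso (gshift 1 (Syz Theta)) (Gamma_star F).
Proof.
case: regular => hnzd hreg _.
pose d (r : 'I_2) := if r == 0 then d1 else d2.
have hom i j : Theta i j \is (d i).-homog.
  by case: (ord2P i) => ->; [apply: homog1|apply: homog2].
have h0 : (Theta *m euler k) 0 0 != 0.
  by apply/eqP => e; have := hnzd 1; rewrite e mul0r => /(_ erefl)/eqP; rewrite oner_eq0.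
have [i [j ij]] := rank2_minor2 h0 rank2.
exists (syz_sheaf Theta); split; last exact: (syz_griso h0).
split.
- exact: syz_subsheaf.
- exact: (syz_coherent hom).
- exact: (syz_rank2 hom h0 ij).
- exact: (syz_torsion_free hom h0 hreg).
Qed.
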